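(* If $G$ is a graph that does not contain a propeller as an induced subgraph and $\Delta(G)\geq 3$, then $\chi'(G)=\Delta(G)$.
   Context: All graphs are finite, simple and undirected. A propeller $(C,x)$ is a graph consisting of a chordless cycle $C$ (the rim) and a node $x\notin V(C)$ (the center) that has at least two neighbors on $C$. $\Delta(G)$ is the maximum degree of $G$ and $\chi'(G)$ is its chromatic index (the least $k$ such that the edges can be colored with $k$ colors so that adjacent edges get distinct colors). *)

(* Defs.v *)
From mathcomp Require Import all_boot.

Set Implicit Arguments.
Unset Strict Implicit.
Unset Printing Implicit Defensive.

Record sgraph := SGraph {
  vertex :> finType;
  adj : rel vertex;
  adj_sym : symmetric adj;
  adj_irrefl : irreflexive adj }.

Section Induced.
Variables (G : sgraph) (S : {set G}).

Definition induced_adj : rel {x : G | x \in S} :=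
  fun x y => adj (val x) (val y).

Lemma induced_sym : symmetric induced_adj.
Proof. by move=> x y; apply: adj_sym. Qed.

Lemma induced_irrefl : irreflexive induced_adj.
Proof. by move=> x; apply: adj_irrefl. Qed.

Definition induced : sgraph := SGraph induced_sym induced_irrefl.

End Induced.

Definition neighbours (G : sgraph) (x : G) : {set G} := [set y | adj x y].

Definition max_degree (G : sgraph) : nat := \max_(x : G) #|neighbours x|.

(* A triangle counts as a chordless cycle. *)
Definition chordless_cycle (G : sgraph) (c : seq G) : Prop :=
  [/\ 2 < size c, uniq c, cycle (@adj G) c
    & {in c &, forall y z, adj y z -> z = next c y \/ y = next c z}].

(* The last clause says that the rim and the center are all of the graph. *)
Definition is_propeller (G : sgraph) : Prop :=
  exists (c : seq G) (x : G),
    [/\ chordless_cycle c, x \notin c,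
        1 < #|[set y in c | adj x y]|
      & forall y : G, y \in x :: c].

Definition contains_induced_propeller (G : sgraph) : Prop :=
  exists S : {set G}, is_propeller (induced S).

Definition edges (G : sgraph) : {set {set G}} :=
  [set [set p.1; p.2] | p in [pred p : G * G | adj p.1 p.2]].

Definition edge (G : sgraph) : finType := {e : {set G} | e \in edges G}.

Definition adjacent_edges (G : sgraph) (e1 e2 : edge G) : bool :=
  (e1 != e2) && (val e1 :&: val e2 != set0).

Definition edge_colorable (G : sgraph) (k : nat) : bool :=
  [exists f : {ffun edge G -> 'I_k},
    [forall e1, forall e2, adjacent_edges e1 e2 ==> (f e1 != f e2)]].

Lemma edge_colorable_ex (G : sgraph) : exists k, edge_colorable G k.
Proof.
exists #|edge G|; apply/existsP; exists [ffun e => enum_rank e].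
apply/forallP=> e1; apply/forallP=> e2; apply/implyP=> /andP[ne12 _].
by rewrite !ffunE (inj_eq enum_rank_inj).
Qed.

Definition chromatic_index (G : sgraph) : nat := ex_minn (edge_colorable_ex G).

(* Main.v *)
Require Import Defs.
From mathcomp Require Import all_boot.

(* Let D be a chordless cycle through b and r, with b far from r, and let s0 be
   a neighbour of r off D that is joined to b outside N[r]. Rerouting D along a
   shortest connection shows that some chordless cycle contains both b and s0,
   unless there is a propeller. Hence in a propeller-free 2-connected graph
   without a clique cutset of size 2, any two non-adjacent vertices lie on a
   common chordless cycle, and the graph obtained by deleting a vertex x
   cannot be of this kind if x has two non-adjacent neighbours in it.

   Suppose that every edge of a chordless cycle C has an end with a neighbour
   in a connected set K off C, and take K minimal. For x in C without
   neighbours in K, deleting x from C u K thus leaves an edge uw, with u in C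
   and w in K, that separates the two neighbours of x. A smallest side of such
   a separation {x, u, w} contains another such x, whose separation has a
   strictly smaller side: a contradiction. So some edge of C has both ends
   without neighbours in K.

   In a 2-connected graph, take for K a largest component left by a chordless
   cycle C. A vertex of C with a neighbour in another component but none in K
   would allow rerouting C so as to enlarge K; so the edge above has both ends
   of degree 2. Such an edge can be removed when colouring with at least 3
   colours, and graphs that are not 2-connected are coloured blockwise. *)

Set Implicit Arguments.
Unset Strict Implicit.
Unset Printing Implicit Defensive.

(** * Induced paths in a symmetric irreflexive relation *)

Section InducedPaths.
Variables (T : finType) (e : rel T).
Hypotheses (esym : symmetric e) (eirr : irreflexive e).

Definition far (x y : T) := (x != y) && ~~ e x y.

Lemma far_sym : symmetric far.
Proof. by move=> x y; rewrite /far eq_sym esym. Qed.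

(** The list of vertices of an induced path. Since [far] includes inequality and [e] is irreflexive,
    such a list has no repetitions. *)
Fixpoint ipath (s : seq T) :=
  if s is x :: s' then
    ipath s' && (if s' is y :: s'' then e x y && all (far x) s'' else true)
  else true.

Lemma adj_neq x y : e x y -> x != y.
Proof. by apply: contraTneq => ->; rewrite eirr. Qed.

Lemma ipath_cons x y s :
  ipath [:: x, y & s] = [&& ipath (y :: s), e x y & all (far x) s].
Proof. by []. Qed.

Lemma ipath_cat s x y t :
  ipath (rcons s x) -> ipath (y :: t) -> e x y -> all (far x) t ->
  allrel far s (y :: t) -> ipath (rcons s x ++ y :: t).
Proof.
move=> + It exy fx; elim: s => [_ _|a [|b s] IHs].
- by rewrite [rcons _ _ ++ _]/= ipath_cons It exy.
- rewrite allrel_consl => /andP[_ /andP[eax _]] /andP[fa _].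
  by rewrite [rcons _ _ ++ _]/= !ipath_cons It exy fx eax.
rewrite allrel_consl !rcons_cons ipath_cons => /and3P[I eab fa] /andP[fay f].
by rewrite !cat_cons ipath_cons -cat_cons IHs //= eab all_cat fa.
Qed.

Lemma ipath_catl s t : ipath (s ++ t) -> ipath s.
Proof.
elim: s => //= x s IHs /andP[/IHs-> /=].
by case: s {IHs} => //= y s; rewrite all_cat => /and3P[-> ->].
Qed.

Lemma ipath_catr s t : ipath (s ++ t) -> ipath t.
Proof. by elim: s => //= x s IHs /andP[/IHs]. Qed.

Lemma ipath_far s x t : ipath (s ++ x :: t) -> allrel far s t.
Proof.
elim: s => [|a s IHs I]; first by rewrite allrel0l.
rewrite allrel_consl (IHs (ipath_catr (s := [:: a]) I)) andbT.
case: s {IHs} I => [|b s] /and3P[_ _ //].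
by rewrite all_cat /= => /and3P[].
Qed.

Lemma ipath_rev s : ipath (rev s) = ipath s.
Proof.
suff imp u : ipath u -> ipath (rev u).
  by apply/idP/idP => [/imp|/imp//]; rewrite revK.
elim: u => // x [|y u] IHu //; rewrite ipath_cons => /and3P[/IHu I exy fx].
rewrite rev_cons -cats1 (rev_cons y); apply: ipath_cat; rewrite -?rev_cons //.
  by rewrite esym.
by rewrite allrel1r all_rev; apply: sub_all fx => z; rewrite far_sym.
Qed.

Lemma ipath_uniq s : ipath s -> uniq s.
Proof.
elim: s => // x [|y s] IHs //; rewrite ipath_cons => /and3P[/IHs U exy fx].
rewrite cons_uniq U andbT inE negb_or (adj_neq exy) /=.
by apply/negP => /(allP fx); rewrite /far eqxx.
Qed.

Lemma ipath_path x s : ipath (x :: s) -> path e x s.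
Proof.
by elim: s x => // y s IHs x; rewrite ipath_cons => /and3P[/IHs /= -> ->].
Qed.

Lemma split_last (a : pred T) s : has a s ->
  exists s1 x s2, [/\ s = s1 ++ x :: s2, a x & ~~ has a s2].
Proof.
elim: s => //= x s IHs; case: (boolP (has a s)) => [/IHs h _|ns].
  by case: h => s1 [y [s2 [-> ay n2]]]; exists (x :: s1), y, s2.
by rewrite orbF => ax; exists [::], x, s.
Qed.

Lemma split_first (a : pred T) s : has a s ->
  exists s1 x s2, [/\ s = s1 ++ x :: s2, a x & ~~ has a s1].
Proof.
rewrite -has_rev => /split_last[s1 [x [s2 [E ax n2]]]].
exists (rev s2), x, (rev s1); split; rewrite ?has_rev //.
by rewrite -[s]revK E rev_cat rev_cons cat_rcons.
Qed.

(** * Connectivity inside a set of vertices *)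

Definition con_in (S : {set T}) : rel T :=
  connect [rel x y | [&& x \in S, y \in S & e x y]].

Lemma con_sym S : symmetric (con_in S).
Proof.
apply: sym_connect_sym => x y /=.
by rewrite esym; case: (x \in S); case: (y \in S).
Qed.

(** This holds for [x] outside [S] too, because [connect] is reflexive; that is why [component] asks
    for membership in [S] separately. *)
Lemma con_refl S x : con_in S x x.
Proof. exact: connect0. Qed.

Lemma con_trans S : transitive (con_in S).
Proof. exact: connect_trans. Qed.

Lemma con_edge (S : {set T}) x y : x \in S -> y \in S -> e x y -> con_in S x y.
Proof. by move=> xS yS exy; apply: connect1; rewrite /= xS yS. Qed.

(** Induction along a walk in [S]: a property preserved by each of its edges passes from one end to
    the other. *)
Lemma con_closed (S : {set T}) (P : T -> Prop) x y :
  (forall a b, P a -> b \in S -> a \in S -> e a b -> P b) ->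
  con_in S x y -> P x -> P y.
Proof.
move=> cl /connectP[s p ->] {y}.
elim: s x p => //= y s IHs x /andP[/and3P[xS yS exy] p] Px.
by apply: IHs p _; apply: cl exy.
Qed.

Lemma con_sub (S S' : {set T}) x y : S \subset S' -> con_in S x y -> con_in S' x y.
Proof.
move=> sub; apply: connect_sub => a b /and3P[aS bS eab].
by apply: con_edge; rewrite ?(subsetP sub).
Qed.

Lemma con_ipath (S : {set T}) s x y :
  ipath s -> {subset s <= S} -> x \in s -> y \in s -> con_in S x y.
Proof.
case: s => // h s I sub; suff hz z : z \in h :: s -> con_in S h z.
  by move=> /hz + /hz; rewrite con_sym; apply: con_trans.
elim: s h I sub z => [|k s IHs] h I sub z.
  by rewrite inE => /eqP->; apply: con_refl.
rewrite inE => /predU1P[->|zs]; first exact: con_refl.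
move: I; rewrite ipath_cons => /and3P[I ehk _].
apply: con_trans (IHs k I _ z zs); last by move=> u us; rewrite sub // inE us orbT.
by apply: con_edge ehk; apply: sub; rewrite !inE eqxx ?orbT.
Qed.

(** A walk is shortened to an induced path and stopped at the first vertex satisfying [Q]. Choosing
    [Q] as adjacency to a target makes all vertices but the last non-adjacent to that target. *)
Lemma ipath_exists (S : {set T}) (Q : pred T) x t :
  x \in S -> con_in S x t -> Q t ->
  exists s, [/\ ipath (x :: s), {subset x :: s <= S}, Q (last x s)
    & ~~ has Q (belast x s)].
Proof.
move=> xS /connectP[w p ->] {t}; elim: w x xS p => [|y w IHw] x xS /=.
  move=> _ Qx; exists [::]; split=> //= z; rewrite inE => /eqP->//.
move=> /andP[/and3P[_ yS exy] pw] Qw.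
have [s [I sub Ql nQ]] := IHw y yS pw Qw.
have [Qx|nQx] := boolP (Q x).
  by exists [::]; split=> //= z; rewrite inE => /eqP->.
(* Cutting at the last vertex equal or adjacent to [x] leaves nothing later that [x] could see. *)
have [|s1 [v [s2 [E av n2]]]] := @split_last (fun v => (x == v) || e x v) (y :: s).
  by rewrite /= exy orbT.
have Iv : ipath (v :: s2) by apply: (@ipath_catr s1); rewrite -E.
have subv : {subset v :: s2 <= S}.
  by move=> z zs; apply: sub; rewrite E mem_cat zs orbT.
have El : last y s = last v s2 by rewrite -[last y s]/(last y (y :: s)) E last_cat.
have nQv : ~~ has Q (belast v s2).
  apply: contra nQ => /hasP[z zs Qz]; apply/hasP; exists z => //.
  case: s1 E => [[-> ->]//|h s1 [-> ->]].
  by rewrite belast_cat /= mem_cat inE zs !orbT.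
case/orP: av => [/eqP xv|exv].
  by exists s2; rewrite xv; split=> //; rewrite -El.
exists (v :: s2); split => //=.
- move: Iv => /= ->; rewrite exv /=; apply/allP => z zs.
  by have /hasPn/(_ z zs) := n2; rewrite negb_or.
- by move=> z; rewrite inE => /predU1P[->//|/subv].
- by rewrite -El.
- by rewrite (negbTE nQx).
Qed.

Definition connected (S : {set T}) := [forall x in S, forall y in S, con_in S x y].

Lemma connP (S : {set T}) :
  reflect {in S &, forall x y, con_in S x y} (connected S).
Proof.
apply: (iffP forall_inP) => [h x y xS yS|h x xS]; first exact: (forall_inP (h x xS)).
by apply/forall_inP => y; apply: h.
Qed.

Lemma conn_hub (S : {set T}) h : {in S, forall x, con_in S h x} -> connected S.
Proof.
move=> ch; apply/connP => x y /ch + /ch; rewrite con_sym; exact: con_trans.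
Qed.

Definition component (S : {set T}) x : {set T} := [set y in S | con_in S x y].

Lemma component_sub S x : component S x \subset S.
Proof. by apply/subsetP => y; rewrite inE => /andP[]. Qed.

Lemma mem_component (S : {set T}) x : x \in S -> x \in component S x.
Proof. by move=> xS; rewrite inE xS con_refl. Qed.

Lemma component_closed (S : {set T}) x a b :
  a \in component S x -> b \in S -> e a b -> b \in component S x.
Proof.
rewrite !inE => /andP[aS ca] bS eab; rewrite bS.
by apply: con_trans ca _; apply: con_edge.
Qed.

Lemma component_con (S : {set T}) x y : x \in S -> con_in S x y -> con_in (component S x) x y.
Proof.
move=> xS c; pose P z := (z \in component S x) && con_in (component S x) x z.
suff: P y by case/andP.
apply: (con_closed (P := P)) c _; last by rewrite /P mem_component // con_refl.
move=> a b /andP[aC ca] bS aS eab; have bC := component_closed aC bS eab.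
by rewrite /P bC; apply: con_trans ca _; apply: con_edge.
Qed.

Lemma component_conn (S : {set T}) x : x \in S -> connected (component S x).
Proof.
move=> xS; apply: (@conn_hub _ x) => y; rewrite inE => /andP[_].
exact: component_con.
Qed.


(** * Chordless cycles *)

(* A chordless cycle, triangles included, is a vertex [x] closing up an induced
   path that it sees only at the two ends. *)
Definition cyc x y q z :=
  [&& ipath (y :: rcons q z), e x y, e x z & all (far x) q].

Definition hole (s : seq T) :=
  exists x y q z, s = [:: x, y & rcons q z] /\ cyc x y q z.

Lemma cyc_hole x y q z : cyc x y q z -> hole [:: x, y & rcons q z].
Proof. by exists x, y, q, z. Qed.

Lemma cyc_rev x y q z : cyc x y q z -> cyc x z (rev q) y.
Proof.
rewrite /cyc all_rev -rev_cons -rev_rcons => /and4P[I -> -> ->].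
by rewrite ipath_rev rcons_cons I.
Qed.

Lemma hole_rot1 s : hole s -> hole (rot 1 s).
Proof.
move=> [x [y [[|h q] [z [-> /and4P[I exy exz fx]]]]]]; rewrite rot1_cons.
  exists y, z, [::], x; split=> //; rewrite /cyc /= andbT (esym z) exz.
  by rewrite (esym y x) exy; move: I => /=; rewrite !andbT => ->.
move: I fx; rewrite [rcons (h :: q) z]/= => /and3P[I eyh fy] /andP[fxh fx].
exists y, h, (rcons q z), x; split=> //.
move: fy; rewrite all_rcons => /andP[fyz fy].
rewrite /cyc eyh (esym y) exy all_rcons fyz fy !andbT.
rewrite -[rcons (rcons q z) x]cats1 -cat_cons -rcons_cons.
apply: ipath_cat; rewrite ?(esym z) // allrel1r /= far_sym fxh /=.
by apply: sub_all fx => w; rewrite far_sym.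
Qed.

Lemma hole_rot_at s r : hole s -> r \in s ->
  exists y q z, cyc r y q z /\ rot (index r s) s = [:: r, y & rcons q z].
Proof.
move=> hs rs; have hrot n : n <= size s -> hole (rot n s).
  elim: n => [|n IHn] n_le; first by rewrite rot0.
  by rewrite rotS //; apply/hole_rot1/IHn/ltnW.
have := hrot (index r s) (index_size _ _).
rewrite rot_index // => -[x [y [q [z [[<- E] c]]]]].
by exists y, q, z; split; rewrite // E.
Qed.

Lemma hole_at s r : hole s -> r \in s ->
  exists y q z, cyc r y q z /\ s =i [:: r, y & rcons q z].
Proof.
move=> hs rs; have [y [q [z [c E]]]] := hole_rot_at hs rs.
by exists y, q, z; split=> // v; rewrite -E mem_rot.
Qed.

(** Go from a neighbour of [p] to the first neighbour of [q], then cut at the last neighbour of [p]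
    on the way. Whether [p] and [q] are adjacent is left open: an edge closes the path to a rim, and
    otherwise two such paths can be glued. *)
Lemma ends_path (S : {set T}) p q u0 v0 :
  connected S -> p \notin S -> q \notin S ->
  u0 \in S -> e p u0 -> v0 \in S -> e q v0 ->
  exists u t, [/\ ipath (u :: rcons t q), {subset u :: t <= S}, e p u
    & all (far p) t].
Proof.
move=> /connP cS pS qS uS epu vS eqv.
have [s [I sub eql nq]] := ipath_exists uS (cS _ _ uS vS) eqv.
have [|s1 [u [t [E eu nt]]]] := @split_last (e p) (u0 :: s); first by rewrite /= epu.
have subu : {subset u :: t <= S}.
  by move=> w wt; apply: sub; rewrite E mem_cat wt orbT.
exists u, t; split=> //; last first.
  apply/allP => w wt; rewrite /far (hasPn nt _ wt) andbT.
  by apply: contraNneq pS => ->; apply: subu; rewrite inE wt orbT.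
have Iu : ipath (u :: t) by apply: (@ipath_catr s1); rewrite -E.
have El : last u0 s = last u t by rewrite -[last u0 s]/(last u0 (u0 :: s)) E last_cat.
have nqu : ~~ has (e q) (belast u t).
  apply: contra nq => /hasP[w ws Qw]; apply/hasP; exists w => //.
  case: s1 E => [[-> ->]//|h s1 [-> ->]].
  by rewrite belast_cat /= mem_cat inE ws !orbT.
rewrite -rcons_cons lastI -cats1; apply: ipath_cat; rewrite -?lastI //.
  by rewrite esym -El.
rewrite allrel1r; apply/allP => w wb; rewrite far_sym /far (hasPn nqu) // andbT.
apply: contraNneq qS => ->; apply: subu; exact: mem_belast.
Qed.

(** The rim leaves [b] through [h] and comes back from the first other neighbour of [b] met on an
    induced path inside [S]. *)
Lemma path_hole (S : {set T}) b h k : connected S -> b \notin S -> h \in S -> k \in S ->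
  e b h -> e b k -> k != h ->
  exists m l, cyc b h m l /\ {subset h :: rcons m l <= S}.
Proof.
move=> cS bS hS kS ebh ebk kh.
have [|m [I sub Ql nQ]] := @ipath_exists _ (fun v => e b v && (v != h)) h k hS (connP _ cS _ _ hS kS).
  by rewrite ebk.
case/lastP: m I sub Ql nQ => [|m l] I sub; first by rewrite /= eqxx andbF.
rewrite last_rcons belast_rcons => /andP[ebl lh] nQ.
have U := ipath_uniq I; exists m, l; split=> //; rewrite /cyc I ebh ebl /=.
apply/allP => v vm; have vh : v != h.
  by apply: contraTneq U => <-; rewrite cons_uniq mem_rcons inE vm orbT.
have := hasPn nQ v; rewrite inE vm orbT vh andbT => /(_ isT) nbv.
rewrite /far nbv andbT; apply: contraNneq bS => ->.
by apply: sub; rewrite inE mem_rcons inE vm !orbT.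
Qed.

Lemma onehole (S : {set T}) p q u0 v0 :
  connected S -> p \notin S -> q \notin S ->
  u0 \in S -> e p u0 -> v0 \in S -> e q v0 -> e p q ->
  exists s, [/\ hole s, p \in s, q \in s
    & forall w, w \in s -> [|| w == p, w == q | w \in S]].
Proof.
move=> cS pS qS uS epu vS eqv epq.
have [u [t [I sub eu f]]] := ends_path cS pS qS uS epu vS eqv.
exists [:: p, u & rcons t q]; split.
- by apply: cyc_hole; rewrite /cyc I eu epq f.
- by rewrite inE eqxx.
- by rewrite !inE mem_rcons inE eqxx !orbT.
move=> w; rewrite !inE mem_rcons inE => /or4P[->//|/eqP->|->|wt].
- by rewrite sub ?orbT ?mem_head.
- by rewrite orbT.
by rewrite (sub w) ?orbT // inE wt orbT.
Qed.

(** The two paths given by [ends_path], one in each set, are glued at [q] and closed up at [p]; no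
    chord can join the mutually far sets. *)
Lemma twohole (S1 S2 : {set T}) p q u1 v1 u2 v2 :
  connected S1 -> connected S2 -> p \notin S1 -> q \notin S1 -> p \notin S2 -> q \notin S2 ->
  {in S1 & S2, forall a b, far a b} ->
  u1 \in S1 -> e p u1 -> v1 \in S1 -> e q v1 ->
  u2 \in S2 -> e p u2 -> v2 \in S2 -> e q v2 -> far p q ->
  exists s, [/\ hole s, p \in s, q \in s
    & forall w, w \in s -> [|| w == p, w == q, w \in S1 | w \in S2]].
Proof.
move=> c1 c2 p1 q1 p2 q2 f12 uS1 epu1 vS1 eqv1 uS2 epu2 vS2 eqv2 fpq.
have [{u1 v1 uS1 epu1 vS1 eqv1} u1 [t1 [I1 s1 eu1 f1]]] := ends_path c1 p1 q1 uS1 epu1 vS1 eqv1.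
have [{u2 v2 uS2 epu2 vS2 eqv2} u2 [t2 [I2 s2 eu2 f2]]] := ends_path c2 p2 q2 uS2 epu2 vS2 eqv2.
exists [:: p, u1 & rcons (t1 ++ q :: rev t2) u2]; split.
- apply: cyc_hole; rewrite /cyc eu1 eu2 all_cat f1 [all _ (q :: _)]/= fpq all_rev f2 !andbT.
  have -> : u1 :: rcons (t1 ++ q :: rev t2) u2 =
     rcons (belast u1 t1) (last u1 t1) ++ q :: rev (u2 :: t2).
    by rewrite -lastI rev_cons rcons_cat.
  have I1' : ipath (belast u1 t1 ++ last u1 t1 :: [:: q]).
    by rewrite -cat_rcons -lastI cats1.
  apply: ipath_cat.
  + by rewrite -lastI; apply: (@ipath_catl _ [:: q]); rewrite cats1.
  + by rewrite -rev_rcons ipath_rev.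
  + by have := ipath_path I1; rewrite rcons_path => /andP[].
  + by rewrite all_rev; apply/allP => w /s2; apply: f12; apply/s1/mem_last.
  + rewrite allrel_consr -allrel1r (ipath_far I1') /=.
    apply/allrelP => a b /mem_belast/s1 aS; rewrite mem_rev => /s2.
    exact: f12.
- by rewrite inE eqxx.
- by rewrite !inE mem_rcons !inE mem_cat inE eqxx !orbT.
move=> w; rewrite !inE mem_rcons !inE mem_cat inE mem_rev.
case/or4P=> [->//|/eqP->|/eqP->|/or3P[wt|->|wt]].
- by rewrite s1 ?mem_head ?orbT.
- by rewrite s2 ?mem_head ?orbT.
- by rewrite (s1 w) ?orbT // inE wt orbT.
- by rewrite orbT.
- by rewrite (s2 w) ?orbT // inE wt orbT.
Qed.

(** A shortest stretch of [L] between the two kinds of vertices. It is always listed from [a] to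
    [b], so it may run against the order of [L]. *)
Lemma segment L (a b : pred T) : ipath L -> has a L -> has b L ->
  {in L, forall v, ~~ (a v && b v)} ->
  exists u m v, [/\ ipath (u :: rcons m v), {subset u :: rcons m v <= L}, a u, b v
    & {in m, forall w, ~~ a w && ~~ b w}].
Proof.
elim: L => // x L IHL I ha hb nab.
have IL : ipath L by apply: (@ipath_catr [:: x]).
have nx := nab x (mem_head _ _).
have [hAL|nA] := boolP (has a L); have [hBL|nB] := boolP (has b L).
- have [|u [m [v [I' sub au bv nm]]]] := IHL IL hAL hBL.
    by move=> w wL; apply: nab; rewrite inE wL orbT.
  by exists u, m, v; split=> // w /sub; rewrite inE orbC => ->.
- have bx : b x by move: hb; rewrite /= (negbTE nB) orbF.
  have [s1 [u [s2 [E au n1]]]] := split_first hAL.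
  have E' : x :: L = (x :: rcons s1 u) ++ s2 by rewrite /= cat_rcons -E.
  have R : u :: rcons (rev s1) x = rev (x :: rcons s1 u).
    by rewrite rev_cons rev_rcons.
  exists u, (rev s1), x; split=> //.
  + by rewrite R ipath_rev; apply: (@ipath_catl _ s2); rewrite -E'.
  + by move=> w; rewrite R mem_rev E' mem_cat => ->.
  + move=> w; rewrite mem_rev => ws; rewrite (hasPn n1) //=.
    by rewrite (hasPn nB) // E mem_cat ws.
- have ax : a x by move: ha; rewrite /= (negbTE nA) orbF.
  have [s1 [v [s2 [E bv n1]]]] := split_first hBL.
  have E' : x :: L = (x :: rcons s1 v) ++ s2 by rewrite /= cat_rcons -E.
  exists x, s1, v; split=> //.
  + by apply: (@ipath_catl _ s2); rewrite -E'.
  + by move=> w ws; rewrite E' mem_cat ws.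
  + by move=> w ws; rewrite (hasPn n1) // (hasPn nA) // E mem_cat ws.
- by move: ha hb nx; rewrite /= (negbTE nA) (negbTE nB) !orbF => -> ->.
Qed.

(* The absence of propellers, [s] being the rim and [v] the center. *)
Definition sees_at_most_once :=
  forall s v a b, hole s -> v \notin s -> a \in s -> b \in s -> e v a -> e v b -> a = b.


(** * Rerouting a chordless cycle when there is no propeller *)

Hypothesis once : sees_at_most_once.

(** The rim wanted goes from [r] along [s0], [L], [l] to [d] and back through [q1] and [y]. By
    [once], [l] sees only [d] on [D], so the only possible chords join [y] to [s0 :: L]; the other
    two cases exhibit a propeller. *)
Lemma extend_aux r y q1 d q2 z s0 L l b :
  let D := [:: r, y & rcons (q1 ++ d :: q2) z] in
  cyc r y (q1 ++ d :: q2) z -> ipath (s0 :: rcons L l) -> e r s0 ->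
  all (far r) (rcons L l) -> e l d ->
  {in s0 :: rcons L l, forall v, v \notin D} ->
  {in s0 :: L & q1 ++ d :: q2, forall v a, ~~ e v a} -> b \in rcons q1 d ->
  exists s, [/\ hole s, b \in s, s0 \in s
    & forall v, v \in s -> (v \in D) || (v \in s0 :: rcons L l)].
Proof.
move=> D cD I ers fr eld LD Lq bq.
have hD : hole D := cyc_hole cD.
have /and4P[Ip ery erz frq] := cD.
have dq : d \in q1 ++ d :: q2 by rewrite mem_cat mem_head orbT.
have qD a : a \in q1 ++ d :: q2 -> a \in D.
  by move=> aq; rewrite !inE mem_rcons inE aq !orbT.
have rD : r \in D by rewrite mem_head.
have yD : y \in D by rewrite !inE eqxx orbT.
have zD : z \in D by rewrite !inE mem_rcons inE eqxx !orbT.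
have lL : l \in s0 :: rcons L l by rewrite !inE mem_rcons mem_head orbT.
have subL v : v \in s0 :: L -> v \in s0 :: rcons L l.
  by rewrite !inE mem_rcons inE => /orP[->//|->]; rewrite !orbT.
have farD v a : v \in s0 :: rcons L l -> a \in D -> ~~ e v a -> far v a.
  move=> vL aD nva; rewrite /far nva andbT; apply: contraNneq (LD v vL) => -> //.
have lfar a : a \in D -> a != d -> far l a.
  move=> aD; rewrite -/D => ad; apply: (farD _ _ lL aD).
  by apply: contraNN ad => ela; apply/eqP/(once hD (LD _ lL) aD (qD _ dq)).
have Lfarq v a : v \in s0 :: L -> a \in q1 ++ d :: q2 -> far v a.
  by move=> vL aq; apply: (farD _ _ (subL _ vL) (qD _ aq) _); apply: Lq.
have Up := ipath_uniq Ip.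
have UD : r \notin y :: rcons (q1 ++ d :: q2) z.
  rewrite inE mem_rcons inE !negb_or (adj_neq ery) (adj_neq erz) /=.
  by apply/negP => /(allP frq); rewrite /far eqxx.
have yq : y \notin q1 ++ d :: q2.
  by move: Up => /= /andP[]; rewrite mem_rcons inE negb_or => /andP[].
have zq : z \notin q1 ++ d :: q2.
  by move: Up => /= /andP[_]; rewrite rcons_uniq => /andP[].
have ns0 : s0 \notin D by apply: LD; rewrite mem_head.
have bD : b \in q1 ++ d :: q2.
  by move: bq; rewrite mem_rcons mem_cat !inE => /orP[->|->]; rewrite ?orbT.
have s0L : s0 \in s0 :: L by rewrite mem_head.
have [hy|ny] := boolP (has (e^~ y) (s0 :: L)); last first.
  exists [:: r, s0 & rcons (L ++ l :: d :: rev q1) y]; split.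
  - apply: cyc_hole; rewrite /cyc ers ery !all_cat [all _ (l :: _)]/= all_rev.
    move: fr frq; rewrite all_rcons all_cat [all _ (d :: _)]/= => /andP[-> ->].
    move=> /and3P[-> -> _]; rewrite !andbT.
    have -> : s0 :: rcons (L ++ [:: l, d & rev q1]) y =
              rcons (s0 :: L) l ++ d :: rcons (rev q1) y.
      by rewrite rcons_cat /= cat_rcons.
    have I2 : ipath (y :: rcons q1 d).
      by apply: (@ipath_catl _ (rcons q2 z)); rewrite /= cat_rcons -rcons_cons -rcons_cat.
    apply: ipath_cat => //.
    + by rewrite -rev_cons -rev_rcons ipath_rev rcons_cons.
    + have dn := ipath_uniq I2.
      have dy : y != d.
        by apply: contraTneq dn => ->; rewrite /= mem_rcons mem_head.
      rewrite all_rcons lfar //= all_rev; apply/allP => a aq.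
      apply: lfar; first by apply: qD; rewrite mem_cat aq.
      apply: contraTneq dn => ad.
      by rewrite cons_uniq rcons_uniq -ad aq andbF.
    + apply/allrelP => v a vL; rewrite inE mem_rcons inE mem_rev.
      case/or3P=> [/eqP->|/eqP->|aq].
      * by apply: Lfarq.
      * by apply: (farD _ _ (subL _ vL) yD _); apply: (hasPn ny).
      * by apply: Lfarq; rewrite ?mem_cat ?aq.
  - move: bq; rewrite mem_rcons inE => bq.
    by rewrite !inE mem_rcons inE mem_cat !inE mem_rev; case/orP: bq => ->; rewrite !orbT.
  - by rewrite !inE eqxx orbT.
  - move=> v; rewrite !inE !mem_rcons !inE !mem_cat !inE mem_rev.
    by do ![case/orP] => ->; rewrite ?orbT.
(* The rim passing on the other side of [d] misses [y], which sees on it both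
   [r] and a vertex of the connection. *)
have [hz|nz] := boolP (has (e^~ z) (s0 :: L)); last first.
  have [v vL evy] := hasP hy; pose s := [:: r, s0 & rcons (L ++ l :: d :: q2) z].
  have hs : hole s.
    apply: cyc_hole; rewrite /cyc ers erz !all_cat [all _ (l :: _)]/=.
    move: fr frq; rewrite all_rcons all_cat [all _ (d :: _)]/= => /andP[-> ->].
    move=> /and3P[_ -> ->]; rewrite !andbT.
    have -> : s0 :: rcons (L ++ [:: l, d & q2]) z =
              rcons (s0 :: L) l ++ d :: rcons q2 z.
      by rewrite rcons_cat /= cat_rcons.
    have I2 : ipath (d :: rcons q2 z).
      by apply: (@ipath_catr (y :: q1)); rewrite cat_cons -rcons_cons -rcons_cat.
    apply: ipath_cat => //.
    + have dn := ipath_uniq I2.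
      have dz : z != d by apply: contraTneq dn => ->; rewrite /= mem_rcons mem_head.
      rewrite all_rcons lfar //=; apply/allP => a aq.
      apply: lfar; first by apply: qD; rewrite mem_cat inE aq !orbT.
      by apply: contraTneq dn => <-; rewrite cons_uniq mem_rcons inE aq orbT.
    + apply/allrelP => w a wL; rewrite inE mem_rcons inE.
      case/or3P=> [/eqP->|/eqP->|aq].
      * by apply: Lfarq.
      * by apply: (farD _ _ (subL _ wL) zD _); apply: (hasPn nz).
      * by apply: Lfarq; rewrite ?mem_cat ?inE ?aq ?orbT.
  have ys : y \notin s.
    apply/negP => ys.
    have : [|| y == r, y \in s0 :: rcons L l | y \in rcons (q1 ++ d :: q2) z].
      move: ys; rewrite !inE !mem_rcons !inE !mem_cat !inE.
      by do ![case/orP] => ->; rewrite ?orbT.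
    rewrite eq_sym (negbTE (adj_neq ery)) /= => /orP[/LD|yp].
      by rewrite yD.
    by move: Up; rewrite cons_uniq yp.
  have rv : r = v.
    apply: (once hs ys); rewrite ?mem_head //.
    - by rewrite !inE mem_rcons inE mem_cat; move: vL; rewrite inE; case/orP => ->; rewrite !orbT.
    - by rewrite esym.
    - by rewrite esym.
  by have := LD _ (subL _ vL); rewrite -rv rD.
(* Now [r] is the center for a rim through both [y] and [z]. *)
have I' : ipath (s0 :: L) by apply: (@ipath_catl _ [:: l]); rewrite cats1.
have nyz : y != z by move: Up => /= /andP[]; rewrite mem_rcons inE negb_or => /andP[].
have [|u [m [v [Iu subm euy evz nm]]]] := segment I' hy hz.
  move=> v vL; apply: contra nyz => /andP[evy evz]; apply/eqP.
  exact: (once hD (LD _ (subL _ vL)) yD zD).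
have uL : u \in s0 :: L by apply: subm; rewrite mem_head.
have vL : v \in s0 :: L by apply: subm; rewrite inE mem_rcons mem_head orbT.
have mL w : w \in m -> w \in s0 :: L.
  by move=> wm; apply: subm; rewrite inE mem_rcons inE wm !orbT.
case E : (q1 ++ d :: q2) => [|h q]; first by rewrite E in dq.
have hs : hole [:: y, u & rcons (m ++ v :: z :: rev q) h].
  have Iz : ipath (y :: h :: rcons q z) by rewrite -rcons_cons -E.
  move: (Iz); rewrite ipath_cons => /and3P[Iz' eyh fy].
  apply: cyc_hole; rewrite /cyc eyh (esym y u) euy !all_cat [all _ (v :: _)]/= all_rev.
  move: fy; rewrite all_rcons => /andP[-> ->].
  have fy w : w \in s0 :: L -> ~~ e w y -> far y w.
    by move=> wL nwy; rewrite far_sym; apply: farD (subL _ wL) yD nwy.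
  have -> : far y v.
    apply: fy => //; apply: contra nyz => evy; apply/eqP.
    exact: (once hD (LD _ (subL _ vL)) yD zD).
  have -> : all (far y) m.
    by apply/allP => w wm; apply: fy (mL _ wm) _; have /andP[] := nm w wm.
  rewrite !andbT.
  have -> : u :: rcons (m ++ [:: v, z & rev q]) h =
            rcons (u :: m) v ++ z :: rcons (rev q) h.
    by rewrite rcons_cat /= cat_rcons.
  apply: ipath_cat => //.
  - by rewrite -rev_cons -rev_rcons ipath_rev.
  - rewrite all_rcons all_rev; apply/andP; split.
      by apply: Lfarq; rewrite ?E ?mem_head.
    by apply/allP => a aq; apply: Lfarq; rewrite ?E ?inE ?aq ?orbT.
  - apply/allrelP => w a; rewrite inE => wum; rewrite inE mem_rcons inE mem_rev.
    have wL : w \in s0 :: L by case/predU1P: wum => [->//|/mL].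
    case/predU1P=> [->|aq]; last by apply: Lfarq; rewrite ?E ?inE.
    case/predU1P: wum => [->|wm].
      apply: (farD _ _ (subL _ uL) zD _); apply: contra nyz => euz.
      by apply/eqP; exact: (once hD (LD _ (subL _ uL)) yD zD).
    by apply: (farD _ _ (subL _ wL) zD _); have /andP[] := nm w wm.
have rs : r \notin [:: y, u & rcons (m ++ v :: z :: rev q) h].
  have rL w : w \in s0 :: L -> r != w.
    by move=> wL; apply: contraNneq (LD _ (subL _ wL)) => <-.
  move: UD; rewrite E !inE !mem_rcons !inE mem_cat !inE mem_rev !negb_or.
  move=> /and4P[-> -> -> ->] /=; rewrite !rL //= andbT.
  by apply/negP => /mL/rL; rewrite eqxx.
have : y = z.
  apply: (once hs rs); rewrite ?mem_head //.
  by rewrite !inE mem_rcons inE mem_cat !inE eqxx !orbT.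
by move/eqP; rewrite (negbTE nyz).
Qed.


(** The connection from [s0] towards [b] is stopped at the first vertex [l] that sees the part [q]
    of the rim far from [r]. This produces the configuration of [extend_aux], with [d] the neighbour
    of [l] in [q]. *)
Lemma extend s r b s0 (S : {set T}) :
  hole s -> r \in s -> b \in s -> far r b -> s0 \notin s -> e r s0 ->
  s0 \in S -> {in S, forall v, v = s0 \/ far r v} -> con_in S s0 b ->
  exists s', [/\ hole s', b \in s', s0 \in s'
    & forall v, v \in s' -> (v \in s) || (v \in S)].
Proof.
move=> hs rs bs frb ns0 ers s0S fS cb.
have [y [q [z [cD sE]]]] := hole_at hs rs.
have /and4P[Ip ery erz frq] := cD.
have qs a : a \in q -> a \in s by move=> aq; rewrite sE !inE mem_rcons inE aq !orbT.
have bq : b \in q.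
  move: bs; rewrite sE !inE mem_rcons inE; move: frb; rewrite /far eq_sym.
  case/andP=> /negbTE-> nrb /= /or3P[/eqP bE|/eqP bE|//].
    by rewrite bE ery in nrb.
  by rewrite bE erz in nrb.
pose Q v := (v \in q) || has (e v) q.
have Qb : Q b by rewrite /Q bq.
have [p [I sub Ql nQ]] := ipath_exists s0S cb Qb.
have rq : r \notin q by apply/negP => /(allP frq); rewrite /far eqxx.
have s0q : s0 \notin q by apply: contra ns0; apply: qs.
(* The connection is not reduced to [s0]: with a neighbour in [q] besides [r], the vertex [s0] would
   be the center of a propeller. *)
case/lastP: p I sub Ql nQ => [|L l] I sub Ql nQ.
  move: Ql; rewrite /Q (negbTE s0q) /= => /hasP[d dq esd].
  suff rd : r = d by rewrite rd dq in rq.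
  by apply: (once hs ns0 rs (qs _ dq)); rewrite // esym.
rewrite last_rcons in Ql; rewrite belast_rcons in nQ.
have lq : l \notin q.
  apply: contra nQ => lq; apply/hasP; exists (last s0 L); first exact: mem_last.
  apply/orP; right; apply/hasP; exists l => //.
  by have := ipath_path I; rewrite rcons_path => /andP[].
move: Ql; rewrite /Q (negbTE lq) /= => /hasP[d dq eld].
have U := ipath_uniq I.
have fr v : v \in rcons L l -> far r v.
  move=> vL; have [|vs0|//] := fS v; first by apply: sub; rewrite inE vL orbT.
  by move: U; rewrite cons_uniq -vs0 vL.
have offq v : v \in s0 :: rcons L l -> v \notin q.
  rewrite -rcons_cons mem_rcons inE => /predU1P[->//|vL].
  by have := hasPn nQ v vL; rewrite negb_or => /andP[].
have off v : v \in s0 :: rcons L l -> v \notin s.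
  move=> vL; move: (vL); rewrite inE => /predU1P[->//|/fr/andP[nrv nev]].
  rewrite sE !inE mem_rcons inE (negbTE (offq v vL)) (eq_sym v r) (negbTE nrv) orbF /=.
  by apply/negP => /orP[] /eqP vE; rewrite vE ?ery ?erz in nev.
have Lq : {in s0 :: L & q, forall v a, ~~ e v a}.
  move=> v a /(hasPn nQ); rewrite negb_or => /andP[_ /hasPn h] aq.
  exact: h.
suff [s' [hs' bs' ss' sub']] : exists s', [/\ hole s', b \in s', s0 \in s'
    & forall v, v \in s' -> (v \in s) || (v \in s0 :: rcons L l)].
  exists s'; split=> // v /sub' /orP[->//|/sub ->]; exact: orbT.
have frL : all (far r) (rcons L l) by apply/allP.
have [q1 [q2 E]] : exists q1 q2, q = q1 ++ d :: q2.
  by case/splitPr: dq => q1 q2; exists q1, q2.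
rewrite E in cD sE bq Lq.
have [bq1|bq1] := boolP (b \in rcons q1 d).
  have [|s' [h1 h2 h3 h4]] := extend_aux cD I ers frL eld _ Lq bq1.
    by move=> v /off; rewrite sE.
  by exists s'; split=> // v /h4; rewrite sE.
(* Here [b] lies beyond [d], so the rim is read in the opposite direction. *)
have cD' := cyc_rev cD; rewrite rev_cat rev_cons cat_rcons in cD'.
have sE' : s =i [:: r, z & rcons (rev q2 ++ d :: rev q1) y].
  move=> v; rewrite sE !(inE, mem_rcons, mem_cat, mem_rev).
  by case: (v == r) (v == z) (v == y) (v == d) (v \in q1) (v \in q2) => [] [] [] [] [] [].
have [|||s' [h1 h2 h3 h4]] := @extend_aux _ _ _ _ _ _ _ _ _ b cD' I ers frL eld.
- by move=> v /off; rewrite sE'.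
- move=> v a vL; rewrite mem_cat inE !mem_rev => aq; apply: Lq => //.
  by rewrite mem_cat inE; case/or3P: aq => ->; rewrite ?orbT.
- move: bq bq1; rewrite !mem_rcons !inE mem_cat inE mem_rev.
  by case: (b == d); case: (b \in q1).
by exists s'; split=> // v /h4; rewrite sE'.
Qed.

(** * Chordless cycles through two non-adjacent vertices *)

Definition far_set (H : {set T}) x := [set v in H | far x v].

(** Neither a vertex (the case [z = r]) nor the two ends of an edge separate [H]: there is no clique
    cutset of size 1 or 2. *)
Definition inseparable (H : {set T}) :=
  {in H &, forall r z, z = r \/ e r z -> connected (H :\: [set r; z])}.

(* Otherwise the component of [v] off [r], [F] and the attachments of [F]
   shares two attachments with [F], and a rim through both of them has
   center [r]. *)
Lemma far_component (H : {set T}) r b v :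
  inseparable H -> r \in H -> b \in far_set H r -> v \in H -> v != r ->
  let F := component (far_set H r) b in
  v \in F \/ e r v /\ exists2 f, f \in F & e v f.
Proof.
move=> sep rH bF vH vr F.
pose Z := [set z in H | e r z && [exists f in F, e z f]].
have [vF|vF] := boolP (v \in F); first by left.
have [vZ|vZ] := boolP (v \in Z).
  by right; move: vZ; rewrite inE => /and3P[_ -> /exists_inP].
exfalso; pose U := H :\: (r |: F :|: Z).
have vU : v \in U by rewrite !in_setD !in_setU in_set1 (negbTE vr) (negbTE vF) (negbTE vZ).
pose L := component U v.
have FH x : x \in F -> (x \in H) * far r x.
  by move=> /(subsetP (component_sub _ _)); rewrite inE => /andP[-> ->].
have bFF : b \in F by apply: mem_component.
have LU x : x \in L -> x \in U by move/(subsetP (component_sub _ _)).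
have LF x y : x \in L -> y \in F -> ~~ e x y.
  move=> /LU; rewrite in_setD !in_setU in_set1 !negb_or -!andbA.
  case/and4P=> xr xF xZ xH yF; apply/negP => exy.
  case: (boolP (e r x)) => erx.
    by case/negP: xZ; rewrite inE xH erx; apply/exists_inP; exists y.
  case/negP: xF; apply: (component_closed yF); last by rewrite esym.
  by rewrite inE xH /far erx eq_sym xr.
have step a a' : a \in L -> a' \in H -> e a a' -> a' != r -> a' \notin Z -> a' \in L.
  move=> aL a'H eaa' a'r a'Z; apply: (component_closed aL _ eaa').
  rewrite in_setD !in_setU in_set1 (negbTE a'r) (negbTE a'Z) a'H !orbF !andbT /=.
  by apply/negP => /(LF _ _ aL); rewrite eaa'.
(* If all edges between [Z] and [L] ended at [z], then [r] and [z] would separate [v] from [b].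
   Taking [z = r] yields a first attachment [z1], and taking [z = z1] a second one. *)
have nosep z : z = r \/ z \in Z -> ~ {in Z & L, forall z' l, e z' l -> z' = z}.
  move=> zZ uz; have [zH rz] : z \in H /\ (z = r \/ e r z).
    by case: zZ => [->|]; [split=> //; left|rewrite inE => /and3P[-> -> _]; split=> //; right].
  have /connP c := sep r z rH zH rz.
  have bZ : b \notin Z.
    have /andP[_ /negbTE nb] := snd (FH b bFF).
    by rewrite inE nb /= andbF.
  have br : b != r by have /andP[] := snd (FH b bFF); rewrite eq_sym.
  have bz : b != z by case: zZ => [->//|zZ]; apply: contraNneq bZ => ->.
  have vz : v != z by case: zZ => [->//|zZ]; apply: contraNneq vZ => ->.
  have cvb : con_in (H :\: [set r; z]) v b.
    by apply: c; rewrite in_setD in_set2 negb_or ?vr ?br ?vz ?bz ?vH // (fst (FH b bFF)).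
  have : b \in L.
    apply: (con_closed (P := fun x => x \in L)) cvb _; last exact: mem_component.
    move=> a a' aL; rewrite in_setD in_set2 negb_or => /andP[/andP[a'r a'z] a'H] _ eaa'.
    apply: (step _ _ aL) => //.
    by apply: contra a'z => a'Z; apply/eqP/(uz _ a a'Z aL); rewrite esym.
  by move/LU; rewrite in_setD !in_setU bFF orbT.
have [z1 z1Z [l1 l1L ezl1]] : exists2 z1, z1 \in Z & exists2 l, l \in L & e z1 l.
  have [/exists_inP[z1 z1Z /exists_inP[l lL ez]]|no] := boolP [exists z1 in Z, exists l in L, e z1 l].
    by exists z1 => //; exists l.
  case: (nosep r (or_introl erefl)) => z' l z'Z lL ez.
  by case/exists_inP: no; exists z' => //; apply/exists_inP; exists l.
have [z2 z2Z [[l2 l2L ezl2] z12]] : exists2 z2, z2 \in Z &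
    (exists2 l, l \in L & e z2 l) /\ z2 != z1.
  have [/exists_inP[z2 z2Z /exists_inP[l lL /andP[ez nz]]]|no] :=
     boolP [exists z2 in Z, exists l in L, e z2 l && (z2 != z1)].
    by exists z2 => //; split=> //; exists l.
  case: (nosep z1 (or_intror z1Z)) => z' l z'Z lL ez.
  apply/eqP/negPn/negP => nz.
  by case/exists_inP: no; exists z' => //; apply/exists_inP; exists l; rewrite ?ez.
have ZE z : z \in Z -> [/\ e r z, z \notin F, z \notin L & exists2 f, f \in F & e z f].
  move=> zZ; move: (zZ); rewrite inE => /and3P[zH erz /exists_inP hf]; split=> //.
    by apply/negP => /FH[_]; rewrite /far erz andbF.
  by apply/negP => /LU; rewrite in_setD !in_setU zZ orbT.
have [er1 z1F z1L [f1 f1F ef1]] := ZE _ z1Z.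
have [er2 z2F z2L [f2 f2F ef2]] := ZE _ z2Z.
have cF : connected F by apply: component_conn.
have cL : connected L by apply: component_conn.
have rF : r \notin F by apply/negP => /FH[_]; rewrite /far eqxx.
have rL : r \notin L by apply/negP => /LU; rewrite in_setD !in_setU set11.
have rz1 := adj_neq er1; have rz2 := adj_neq er2.
suff [s [hs z1s z2s sub]] : exists s, [/\ hole s, z1 \in s, z2 \in s
    & forall w, w \in s -> [|| w == z1, w == z2, w \in L | w \in F]].
  have rs : r \notin s.
    by apply/negP => /sub; rewrite (negbTE rz1) (negbTE rz2) (negbTE rL) (negbTE rF).
  by move/eqP: z12; apply; apply: (once hs rs).
have [e12|e12] := boolP (e z1 z2).
  have [s [hs z1s z2s sub]] := onehole cF z1F z2F f1F ef1 f2F ef2 e12.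
  by exists s; split=> // w /sub /or3P[->|->|->]; rewrite ?orbT.
apply: (twohole cL cF z1L z2L z1F z2F _ l1L ezl1 l2L ezl2 f1F ef1 f2F ef2).
  move=> a b' aL bF'; rewrite /far LF // andbT.
  apply: contraTneq aL => ->; apply/negP => /LU.
  by rewrite in_setD !in_setU bF' orbT.
by rewrite /far e12 eq_sym z12.
Qed.

(** By [far_component], [r0] and [c] are joined by a walk among the vertices far from [b]. The cycle
    through [b] is carried along it: at an edge from [r] to a new vertex [t], a second use of
    [far_component], now around [r], links [t] to [b] outside the neighbourhood of [r], and [extend]
    applies. *)
Lemma common_hole (H : {set T}) s0 b r0 c :
  inseparable H -> hole s0 -> {subset s0 <= H} -> b \in s0 -> r0 \in s0 ->
  far b r0 -> c \in H -> far b c ->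
  exists s, [/\ hole s, {subset s <= H}, b \in s & c \in s].
Proof.
move=> sep h0 sub0 bs0 r0s fr0 cH fc; have bH := sub0 _ bs0.
have r0F : r0 \in far_set H b by rewrite inE sub0.
have cn : c != b by rewrite eq_sym; case/andP: fc.
have [|[ebc _]] := far_component sep bH r0F cH cn; last by case/andP: fc => _; rewrite ebc.
rewrite inE => /andP[_ cr0c].
apply: (con_closed (P := fun v => exists s, [/\ hole s, {subset s <= H}, b \in s & v \in s])) cr0c _; last by exists s0.
move=> r t [s [hs sub bs rs]] tF rF ert.
have [ts|ts] := boolP (t \in s); first by exists s.
have [rH frb] : r \in H /\ far r b by move: rF; rewrite inE far_sym => /andP[].
have [tH _] : t \in H /\ far b t by move: tF; rewrite inE => /andP[].
have bF : b \in far_set H r by rewrite inE bH frb.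
have tr : t != r by rewrite eq_sym adj_neq.
have [|[_ [f fF etf]]] := far_component sep rH bF tH tr.
  by move/(subsetP (component_sub _ _)); rewrite inE /far ert /= !andbF.
pose S := t |: component (far_set H r) b.
have subS : component (far_set H r) b \subset S by apply: subsetUr.
have [|||s' [hs' bs' ts' sub']] := extend hs rs bs frb ts ert (S := S).
- by rewrite setU11.
- move=> v; rewrite !inE => /predU1P[->|/andP[/andP[_ fv] _]]; first by left.
  by right.
- apply: (@con_trans S f); first exact: con_edge (setU11 _ _) (subsetP subS _ fF) etf.
  rewrite con_sym; apply: (con_sub subS); apply: component_con => //.
  by move: fF; rewrite inE => /andP[].
exists s'; split=> // v /sub' /orP[/sub//|].
by rewrite !inE => /predU1P[->//|/andP[/andP[]]].
Qed.


(** * Rims covered by a connected set *)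

Lemma conn0 : connected set0.
Proof. by apply/connP => x y; rewrite inE. Qed.

Lemma conn1 v : connected [set v].
Proof. by apply/connP => x y /set1P-> /set1P->; apply: con_refl. Qed.

Lemma conn_add (Y : {set T}) y v : connected Y -> y \in Y -> e y v -> connected (v |: Y).
Proof.
move=> /connP cY yY eyv; apply: (@conn_hub _ y) => z /setU1P[->|zY].
  by apply: con_edge eyv; rewrite ?setU11 // setU1r.
by apply: (con_sub (subsetU1 v Y)); apply: cY.
Qed.

Lemma conn2 r z : z = r \/ e r z -> connected [set r; z].
Proof.
case=> [->|erz]; first by rewrite setUid; apply: conn1.
by rewrite setUC; apply: (conn_add (y := r)); rewrite ?set11 ?conn1.
Qed.

(** A maximal connected proper subset of [K] containing [X] misses exactly one vertex, since adding
    any adjacent vertex must give [K]. *)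
Lemma noncut (X K : {set T}) : connected X -> connected K -> X \proper K ->
  exists v, [/\ v \in K, v \notin X & connected (K :\ v)].
Proof.
move=> cX /connP cK XK; pose P := [pred Y : {set T} | connected Y && (Y \proper K)].
have [|Y /maxsetP[/andP[cY YK] maxY] XY] := @maxset_exists _ P X; first by rewrite /= cX.
have add v : v \in K -> v \notin Y -> connected (v |: Y) -> connected (K :\ v).
  move=> vK vY cvY; have [pr|npr] := boolP (v |: Y \proper K).
    have E : v |: Y = Y by apply: maxY; rewrite ?subsetU1 //= cvY.
    by rewrite -E setU11 in vY.
  have E : v |: Y = K.
    apply/eqP; rewrite eqEproper npr andbT; apply/subsetP => z /setU1P[->//|].
    exact: (subsetP (proper_sub YK)).
  by rewrite -E setU1K.
have nX v : v \notin Y -> v \notin X by apply/contra/subsetP.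
have [Y0|[y yY]] := set_0Vmem Y.
  have [_ [v vK vY]] := properP YK; exists v; split; rewrite ?nX //.
  by apply: add => //; rewrite Y0 setU0 conn1.
have [_ [v0 v0K v0Y]] := properP YK.
have [/exists_inP[v vK /andP[vY /exists_inP[a aY eav]]]|no] :=
    boolP [exists v in K, (v \notin Y) && [exists a in Y, e a v]].
  by exists v; split; rewrite ?nX ?add // (conn_add cY aY).
case/negP: v0Y; apply: (con_closed (P := fun z => z \in Y) _ (cK y v0 _ v0K) yY).
  move=> a b aY bK _ eab; apply: contraR no => bY; apply/exists_inP; exists b => //.
  by rewrite bY; apply/exists_inP; exists a.
exact: (subsetP (proper_sub YK) _ yY).
Qed.

Lemma noncut_component (R K : {set T}) v r :
  connected K -> connected R -> R \subset K -> r \in R -> v \in K :\: R ->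
  exists v', v' \in component (K :\: R) v /\ connected (K :\ v').
Proof.
move=> cK cR RK rR vKR; pose Y := component (K :\: R) v.
have YK z : z \in Y -> (z \in K) * (z \notin R).
  by move/(subsetP (component_sub _ _)); rewrite inE => /andP[].
have RX : R \subset K :\: Y.
  apply/subsetP => z zR; rewrite inE (subsetP RK) // andbT.
  by apply/negP => /YK[_]; rewrite zR.
have cX : connected (K :\: Y).
  apply: (@conn_hub _ r) => y; rewrite inE => /andP[yY yK].
  suff [] : y \in Y \/ con_in (K :\: Y) r y by rewrite // (negbTE yY).
  apply: (con_closed (P := fun z => z \in Y \/ con_in (K :\: Y) r z))
            (connP _ cK r y (subsetP RK _ rR) yK) _; last by right; apply: con_refl.
  move=> a b h bK aK eab; have [bY|bY] := boolP (b \in Y); first by left.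
  right; have [bR|bR] := boolP (b \in R).
    by apply: (con_sub RX); apply: (connP _ cR).
  case: h => [aY|ca].
    by case/negP: bY; apply: (component_closed aY) eab; rewrite inE bR.
  have [aY|aY] := boolP (a \in Y).
    by case/negP: bY; apply: (component_closed aY) eab; rewrite inE bR.
  by apply: con_trans ca (con_edge _ _ eab); rewrite inE ?aY ?bY.
have [|v' [v'K v'X cv']] := noncut cX cK.
  rewrite properE subsetDl; apply/subsetPn; exists v; last by rewrite inE mem_component.
  by move: vKR; rewrite inE => /andP[].
by exists v'; split=> //; move: v'X; rewrite inE v'K andbT negbK.
Qed.

(** The walk is stopped at its first arrival in [w]. *)
Lemma con_first (K : {set T}) v w : v \in K -> v != w -> con_in K v w ->
  con_in (w |: component (K :\ w) v) v w.
Proof.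
move=> vK vw c; set Y := component _ _.
have vKw : v \in K :\ w by rewrite !inE vw.
suff [//|[_ //]] : con_in (w |: Y) v w \/ w \in Y /\ con_in (w |: Y) v w.
apply: (@con_closed K (fun z => con_in (w |: Y) v w \/ z \in Y /\ con_in (w |: Y) v z) v w _ c).
  move=> a b [|[aY ca]] bK aK eab; first by left.
  have [bw|bw] := eqVneq b w.
    left; apply: con_trans ca (con_edge _ _ _); rewrite ?setU11 ?setU1r //.
    by rewrite -bw.
  have bY : b \in Y by apply: (component_closed aY) eab; rewrite !inE bw.
  by right; split=> //; apply: con_trans ca (con_edge _ _ eab); rewrite setU1r.
by right; split; [apply: mem_component|apply: con_refl].
Qed.

(** On an induced path a neighbour [z] of [r] inside [p1] can only be its last vertex. Hence
    deleting [r] and [z] does not cut [p1]. *)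
Lemma path_reach p1 r p2 z v (S : {set T}) :
  ipath (p1 ++ r :: p2) -> v \in p1 -> v != z -> z = r \/ e r z ->
  {in p1, forall w, w != z -> w \in S} ->
  con_in S v (head v p1) /\ head v p1 != z.
Proof.
move=> I vp vz rz sub.
have [zp|zp] := boolP (z \in p1); last first.
  have hp : head v p1 \in p1 by case: p1 vp {I sub zp} => //= a l; rewrite mem_head.
  split; last by apply: contraNneq zp => <-.
  apply: (con_ipath (ipath_catl I)) => // w wp; apply: sub => //.
  by apply: contraNneq zp => <-.
have {rz} erz : e r z.
  case: rz zp => // -> rp; have := ipath_uniq I.
  by rewrite cat_uniq /= rp /= andbF.
case/splitPr: zp I vp sub => p3 [|h p4] I vp sub; last first.
  move: I; rewrite -catA => /ipath_catr; rewrite !cat_cons ipath_cons all_cat.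
  by case/and3P=> _ _ /andP[_ /andP[/andP[_]]]; rewrite esym erz.
have vp3 : v \in p3 by move: vp; rewrite mem_cat inE (negbTE vz) orbF.
have I3 := ipath_catl (ipath_catl I).
have zp3 : z \notin p3.
  have := ipath_uniq (ipath_catl I); rewrite cat_uniq /= => /and3P[_ + _].
  by rewrite orbF.
have hE : head v (p3 ++ [:: z]) = head v p3 by case: (p3) vp3.
have hp : head v p3 \in p3 by case: (p3) vp3 => //= a l; rewrite mem_head.
rewrite hE; split; last by apply: contraNneq zp3 => <-.
apply: (con_ipath I3) => // w wp; apply: sub; first by rewrite mem_cat wp.
by apply: contraNneq zp3 => <-.
Qed.

(** Deleting [r], and possibly a neighbour of it, from a path leaves two arcs, each still containing
    an end of the path if not empty. The second arc is treated by reversal. *)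
Lemma arc_ends b q c r z v (S : {set T}) :
  ipath (b :: rcons q c) -> r \in b :: rcons q c -> z = r \/ e r z ->
  v \in b :: rcons q c -> v != r -> v != z ->
  {in b :: rcons q c, forall w, w != r -> w != z -> w \in S} ->
  con_in S v b /\ (b != r) && (b != z) \/ con_in S v c /\ (c != r) && (c != z).
Proof.
move=> I rP rz vP vr vz sub.
have [p1 [p2 E]] : exists p1 p2, b :: rcons q c = p1 ++ r :: p2.
  by case/splitPr: rP => p1 p2; exists p1, p2.
rewrite E in I; have U := ipath_uniq I.
have r1 : r \notin p1 by move: U; rewrite cat_uniq /= negb_or => /and3P[_ /andP[]].
have r2 : r \notin p2 by move: U; rewrite cat_uniq /= => /and4P[].
move: vP; rewrite E mem_cat inE (negbTE vr) /= => /orP[v1|v2].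
  have [|] := path_reach I v1 vz rz (S := S).
    move=> w w1 wz; apply: sub wz; first by rewrite E mem_cat w1.
    by apply: contraNneq r1 => <-.
  have -> : head v p1 = b by case: (p1) v1 E => // a l _ [].
  move=> cb bz; left; rewrite bz andbT; split=> //.
  apply: contraNneq r1 => <-; by case: (p1) v1 E => // a l _ [-> _]; rewrite mem_head.
have I' : ipath (rev p2 ++ r :: rev p1) by rewrite -cat_rcons -rev_cons -rev_cat ipath_rev.
have v2' : v \in rev p2 by rewrite mem_rev.
have hE : head v (rev p2) = c.
  have : rev (b :: rcons q c) = rev p2 ++ r :: rev p1 by rewrite E rev_cat rev_cons cat_rcons.
  rewrite -rcons_cons rev_rcons; by case: (rev p2) v2' => // a l _ [].
have [|] := path_reach I' v2' vz rz (S := S).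
  move=> w; rewrite mem_rev => w2 wz; apply: sub wz; first by rewrite E mem_cat inE w2 !orbT.
  by apply: contraNneq r2 => <-.
rewrite hE => cc cz; right; rewrite cz andbT; split=> //.
apply: contraNneq r2 => <-; rewrite -hE -mem_rev.
by case: (rev p2) v2' => // a l _; rewrite mem_head.
Qed.

Lemma cyc_nbr x b q c v : cyc x b q c -> v \in [:: x, b & rcons q c] -> e x v ->
  v = b \/ v = c.
Proof.
case/and4P=> _ _ _ fx; rewrite !inE mem_rcons inE => /or4P[/eqP->|/eqP->|/eqP->|vq] exv.
- by rewrite eirr in exv.
- by left.
- by right.
by have /andP[_] := allP fx v vq; rewrite exv.
Qed.

Definition touch (K : {set T}) a := [exists k in K, e a k].

Lemma touchP (K : {set T}) a : reflect (exists2 k, k \in K & e a k) (touch K a).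
Proof. exact: exists_inP. Qed.


(** * A minimal connected set touching every edge of a rim *)

Section Reduced.
Variables (s : seq T) (K : {set T}).
Hypotheses (hs : hole s) (cK : connected K) (dis : {in K, forall k, k \notin s}).
Hypothesis cov : {in s &, forall a y, e a y -> touch K a || touch K y}.
(* What is left of the minimality of [K] subject to [cov]. *)
Hypothesis priv : forall v, v \in K -> connected (K :\ v) ->
  exists a y, [/\ a \in s, y \in s, e a y, ~~ touch K y
    & e a v /\ {in K, forall k, e a k -> k = v}].

Let sK v : v \in s -> v \notin K.
Proof. by apply: contraL => /dis. Qed.

(** Chordless cycles found in this set avoid [x], which can therefore serve as their center. *)
Definition off x : {set T} := (K :|: [set v in s]) :\ x.

Lemma untouched_far x k : x \in s -> ~~ touch K x -> k \in K -> far x k.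
Proof.
move=> xs nx kK; rewrite /far (_ : x != k); last by apply: contraNneq (dis kK) => <-.
by apply: contra nx => exk; apply/touchP; exists k.
Qed.

(** The component of [v] in [K :\: R] contains a vertex that does not disconnect [K]. By [priv] it
    has a rim neighbour [a] seeing nothing else in [K]; so [a] does not touch the deleted set [R],
    and differs from the untouched [x]. *)
Lemma reach_rim R v x (S : {set T}) r : ~~ touch K x -> x \in s ->
  connected R -> R \subset K -> r \in R -> v \in K :\: R -> K :\: R \subset S ->
  [set a in s] :\ x :\: [set a | [exists k in R, e a k]] \subset S ->
  exists a, [/\ a \in s, a != x, con_in S v a & ~~ [exists k in R, e a k]].
Proof.
move=> nx xs cR RK rR vKR KS sS.
have [v' [v'Y cv']] := noncut_component cK cR RK rR vKR.
have [v'KR cvv'] : v' \in K :\: R /\ con_in (K :\: R) v v'.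
  by move: v'Y; rewrite inE => /andP[].
have [v'K v'R] : v' \in K /\ v' \notin R by move: v'KR; rewrite inE => /andP[].
have [a [y [as_ ys eay ny [eav av]]]] := priv v'K cv'.
have aR : ~~ [exists k in R, e a k].
  apply/exists_inP => -[k kR eak]; case/negP: v'R.
  by rewrite -(av k _ eak) ?(subsetP RK).
have ax : a != x by apply: contraNneq nx => <-; apply/touchP; exists v'.
exists a; split=> //; apply: con_trans (con_sub KS cvv') (con_edge _ _ _).
- by rewrite (subsetP KS).
- by apply: (subsetP sS); rewrite !inE aR ax.
- by rewrite esym.
Qed.

Section Rooted.
Variables (x b : T) (q : seq T) (c : T).
Hypotheses (cx : cyc x b q c) (sE : s =i [:: x, b & rcons q c]).
Hypothesis nx : ~~ touch K x.

Let P := b :: rcons q c.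

Let Ip : ipath P. Proof. by case/and4P: cx. Qed.
Let exb : e x b. Proof. by case/and4P: cx. Qed.
Let exc : e x c. Proof. by case/and4P: cx. Qed.
Let fxq : all (far x) q. Proof. by case/and4P: cx. Qed.
Let bP : b \in P. Proof. by rewrite mem_head. Qed.
Let cP : c \in P. Proof. by rewrite inE mem_rcons mem_head orbT. Qed.
Let xs : x \in s. Proof. by rewrite sE mem_head. Qed.
Let Ps v : v \in P -> v \in s.
Proof. by move=> vP; rewrite sE inE; apply/orP; right. Qed.
Let bs := Ps bP.
Let cs := Ps cP.
Let xP : x \notin P.
Proof.
rewrite inE mem_rcons inE !negb_or (adj_neq exb) (adj_neq exc) /=.
by apply/negP => /(allP fxq); rewrite /far eqxx.
Qed.
Let sP v : v \in s -> v != x -> v \in P.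
Proof. by rewrite sE inE => /predU1P[->|//]; rewrite eqxx. Qed.
Let tb : touch K b.
Proof. by have := cov xs bs exb; rewrite (negbTE nx). Qed.
Let tc : touch K c.
Proof. by have := cov xs cs exc; rewrite (negbTE nx). Qed.
Let bc : b != c.
Proof.
by have := ipath_uniq Ip; rewrite /P /= mem_rcons inE negb_or => /andP[/andP[]].
Qed.
Let P_off v : v \in P -> v \in off x.
Proof.
move=> vP; rewrite !inE (Ps vP) orbT andbT.
by apply: contraNneq xP => <-.
Qed.
Let K_off v : v \in K -> v \in off x.
Proof.
move=> vK; rewrite !inE vK andbT; apply: contraTneq xs => <-; exact: dis.
Qed.
Let off_PK v : v \in off x -> v \in K \/ v \in P.
Proof. by rewrite !inE => /andP[vx /orP[|/sP]]; [left|right; auto]. Qed.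

(** A vertex of [K] first reaches the rim by [reach_rim]; from the rim, an arc of the path from [b]
    to [c] that avoids [u] leads to one of the ends. *)
Lemma pivot_reach u w v : u \in s -> w \in K -> e u w ->
  v \in off x :\: [set u; w] ->
  con_in (off x :\: [set u; w]) v b /\ b != u \/ con_in (off x :\: [set u; w]) v c /\ c != u.
Proof.
move=> us wK euw; set S := off x :\: _.
have ux : u != x by apply: contraNneq nx => <-; apply/touchP; exists w.
have PS a : a \in P -> a != u -> a \in S.
  move=> aP au; rewrite in_setD in_set2 P_off // negb_or au andbT /=.
  by apply: contraTneq wK => <-; apply: sK; apply: Ps.
have vP v' : v' \in P -> v' != u -> con_in S v' b /\ b != u \/ con_in S v' c /\ c != u.
  move=> v'P v'u; have := @arc_ends b q c u u v' S Ip (sP us ux) (or_introl erefl) v'P v'u v'u.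
  by case=> [a aP au _|[cb /andP[nb _]]|[cb /andP[nb _]]]; [apply: PS|left|right].
rewrite in_setD in_set2 negb_or => /andP[/andP[vu vw] /off_PK[vK|]]; last by move/vP; apply.
have [|||||a [as_ ax ca aw]] := @reach_rim [set w] v x S w nx xs (conn1 w).
- by rewrite sub1set.
- by rewrite set11.
- by rewrite !inE vw.
- apply/subsetP => k; rewrite in_setD in_set1 => /andP[kw kK].
  rewrite in_setD in_set2 negb_or kw K_off // !andbT.
  by apply: contraTneq us => <-; apply: dis.
- apply/subsetP => a /setDP[/setD1P[ax as_] aw].
  rewrite inE in as_; rewrite inE in aw.
  apply: PS; first exact: sP.
  by apply: contraNneq aw => ->; apply/exists_inP; exists w; rewrite ?set11.
have au : a != u by apply: contraNneq aw => ->; apply/exists_inP; exists w; rewrite ?set11.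
by case: (vP a (sP as_ ax) au) => -[c1 ->]; [left|right]; split=> //; apply: con_trans ca c1.
Qed.

(** If the deleted vertices both lie in [K], the rim path survives and everything reaches it. If
    both lie on the rim, [K] survives and each arc reaches it through [b] or [c]. The mixed case is
    [pivot_reach], where only a separation of [b] from [c] could do harm. *)
Lemma rooted_inseparable :
  (forall u w, u \in s -> w \in K -> e u w -> u != b -> u != c ->
     con_in (off x :\: [set u; w]) b c) -> inseparable (off x).
Proof.
move=> nopiv.
have mixed u w : u \in s -> w \in K -> e u w -> connected (off x :\: [set u; w]).
  move=> us wK euw; pose S := off x :\: [set u; w].
  have [ub|ub] := eqVneq u b.
    apply: (@conn_hub _ c) => v vS; rewrite con_sym.
    by case: (pivot_reach us wK euw vS) => -[// _]; rewrite ub eqxx.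
  have [uc|uc] := eqVneq u c.
    apply: (@conn_hub _ b) => v vS; rewrite con_sym.
    by case: (pivot_reach us wK euw vS) => -[// _]; rewrite uc eqxx.
  apply: (@conn_hub _ b) => v vS; rewrite con_sym.
  case: (pivot_reach us wK euw vS) => -[// cc _]; apply: con_trans cc _.
  by rewrite con_sym; apply: nopiv.
move=> r z rH zH rz; set S := _ :\: _.
have KS v : v \in K -> v != r -> v != z -> v \in S.
  by move=> vK vr vz; rewrite in_setD in_set2 negb_or vr vz K_off.
have PS v : v \in P -> v != r -> v != z -> v \in S.
  by move=> vP vr vz; rewrite in_setD in_set2 negb_or vr vz P_off.
have ne v w : v \in K -> w \in P -> v != w.
  by move=> vK wP; apply: contraTneq wP => <-; apply: contraL vK => /Ps/sK.
case: (off_PK rH) => [rK|rP]; case: (off_PK zH) => [zK|zP].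
- have PSS : {subset P <= S}.
    by move=> v vP; apply: PS => //; rewrite eq_sym ne.
  apply: (@conn_hub _ b) => v; rewrite in_setD in_set2 negb_or.
  case/andP=> /andP[vr vz] /off_PK[vK|vP]; last exact: con_ipath Ip PSS _ _.
  have [|||||a [as_ ax ca _]] := @reach_rim [set r; z] v x S r nx xs (conn2 rz).
  + by apply/subsetP => k /set2P[]->.
  + by rewrite set21.
  + by rewrite !inE negb_or vr vz.
  + by apply/subsetP => k; rewrite in_setD in_set2 negb_or => /andP[/andP[kr kz] kK]; apply: KS.
  + by apply/subsetP => a /setDP[/setD1P[ax as_] _]; apply/PSS/sP; rewrite ?inE in as_.
  rewrite con_sym; apply: con_trans ca _; apply: con_ipath Ip PSS _ _ => //.
  exact: sP.
- rewrite /S setUC; apply: (mixed _ _ (Ps zP) rK).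
  by case: rz => [zr|]; [rewrite zr in zP; have := ne _ _ rK zP; rewrite eqxx|rewrite esym].
- apply: (mixed _ _ (Ps rP) zK).
  by case: rz => // zr; rewrite zr in zK; have := ne _ _ zK rP; rewrite eqxx.
have KSS : K \subset S by apply/subsetP => k kK; apply: KS; rewrite ?ne.
have [kb kbK ekb] := touchP _ _ tb; have [kc kcK ekc] := touchP _ _ tc.
have KK k : k \in K -> con_in S kb k by move=> kK; apply: (con_sub KSS); apply: (connP _ cK).
apply: (@conn_hub _ kb) => v; rewrite in_setD in_set2 negb_or.
case/andP=> /andP[vr vz] /off_PK[/KK//|vP].
have [//|[cb /andP[br bz]]|[cc /andP[cr cz]]] := arc_ends Ip rP rz vP vr vz (S := S).
  rewrite con_sym; apply: con_trans cb (con_edge _ _ ekb); first exact: PS.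
  exact: (subsetP KSS).
rewrite con_sym; apply: con_trans cc _; rewrite con_sym.
apply: (con_trans (KK _ kcK)); apply: con_edge.
- exact: (subsetP KSS).
- exact: PS.
by rewrite esym.
Qed.

(** Otherwise [off x] is inseparable and [common_hole] gives a chordless cycle through [b] and [c]
    that avoids [x], so [x] is the center of a propeller. *)
Lemma pivot : exists u w, [/\ u \in s, w \in K, e u w, (u != b) && (u != c)
  & ~~ con_in (off x :\: [set u; w]) b c].
Proof.
pose A u w := [&& u \in s, w \in K, e u w, u != b, u != c & ~~ con_in (off x :\: [set u; w]) b c].
have [/existsP[u /existsP[w /and5P[us wK euw ub /andP[uc nc]]]]|no] :=
    boolP [exists u, exists w, A u w].
  by exists u, w; split; rewrite ?ub.
exfalso; have sep : inseparable (off x).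
  apply: rooted_inseparable => u w us wK euw ub uc; apply: contraR no => nc.
  by apply/existsP; exists u; apply/existsP; exists w; apply/and5P; split; rewrite ?uc.
have bad t : hole t -> x \notin t -> b \in t -> c \in t -> False.
  by move=> ht xt bt ct; move/eqP: bc; apply; apply: (once ht xt bt ct).
have [kb kbK ekb] := touchP _ _ tb; have [kc kcK ekc] := touchP _ _ tc.
case E : q => [|h q'].
  have ebc : e b c by move: Ip; rewrite /P E /= !andbT.
  have [t [ht bt ct sub]] := onehole cK (sK bs) (sK cs) kbK ekb kcK ekc ebc.
  apply: (bad t ht _ bt ct); apply/negP => /sub.
  by rewrite (negbTE (adj_neq exb)) (negbTE (adj_neq exc)) (negbTE (sK xs)).
have := Ip; rewrite /P E [rcons _ _]/= ipath_cons all_rcons => /and3P[_ ebh /andP[fbc _]].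
have hP : h \in P by rewrite /P E /= !inE eqxx orbT.
have xkb : x != kb by apply: contraTneq kbK => <-; apply: sK.
have cb : connected (off x :\: [set b; b]) by apply: sep; rewrite ?P_off //; left.
have mem_b v : v \in off x -> v != b -> v \in off x :\: [set b; b].
  by move=> vH vb; rewrite in_setD in_set2 negb_or vb.
have hb : h != b by rewrite eq_sym adj_neq.
have kbb : kb != b by rewrite eq_sym adj_neq.
have hS := mem_b _ (P_off hP) hb; have kbS := mem_b _ (K_off kbK) kbb.
have hkb : kb != h by apply: contraTneq kbK => ->; apply/sK/Ps.
have bbS : b \notin off x :\: [set b; b] by rewrite in_setD in_set2 eqxx.
have [m [l [ct sub]]] := path_hole cb bbS hS kbS ebh ekb hkb.
have ht := cyc_hole ct; have /and4P[I _ ebl fbm] := ct.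
have subH : {subset [:: b, h & rcons m l] <= off x}.
  move=> v; rewrite inE => /predU1P[->|/sub]; first exact: P_off.
  by rewrite in_setD => /andP[].
(* In a triangle on [b], [h], [l], the vertex [l] would be off the rim and see both [b] and [h]. In
   a longer cycle [r0] is far from [b], as [common_hole] requires. *)
case: m I {sub ct} fbm ht subH => [|r0 m] I fbm ht subH.
  have ehl : e h l by move: I; rewrite /= !andbT.
  have lh : l != h by rewrite eq_sym adj_neq.
  have lH : l \in off x by apply: subH; rewrite !inE eqxx !orbT.
  have ls : l \notin s.
    case: (off_PK lH) => [/dis//|lP]; case/negP: lh.
    move: lP; rewrite /P E /= !inE => /or3P[/eqP lb|//|lq].
      by rewrite lb eirr in ebl.
    have := Ip; rewrite /P E [rcons _ _]/= ipath_cons => /and3P[_ _ /allP/(_ l lq)].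
    by rewrite /far ebl andbF.
  suff bh : b = h by rewrite bh eqxx in hb.
  by apply: (once hs ls bs (Ps hP)); rewrite esym.
have fr0 : far b r0 by have /andP[] := fbm.
have [|||||t [ht' subt bt ct]] := common_hole sep ht subH (b := b) (r0 := r0) (c := c).
- by rewrite mem_head.
- by rewrite !inE eqxx !orbT.
- by [].
- exact: P_off.
- by [].
by apply: (bad t ht' _ bt ct); apply/negP => /subt; rewrite !inE eqxx.
Qed.

End Rooted.

(** If all rim vertices in the component [X] of [b] were touched, the neighbour [h] of [b] would see
    a vertex of [K] in [X] off a chosen path [L]. Some such vertex can be removed without
    disconnecting [K], and [priv] then gives it a rim neighbour next to an untouched vertex, for
    which there is no place left. *)
Lemma untouched_rim_vertex x b q c u w :
  cyc x b q c -> s =i [:: x, b & rcons q c] -> ~~ touch K x ->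
  u \in s -> w \in K -> e u w -> u != b -> u != c ->
  ~~ con_in (off x :\: [set u; w]) b c ->
  exists2 v, v \in component (off x :\: [set u; w]) b & (v \in s) && ~~ touch K v.
Proof.
move=> cx sE nx us wK euw ub uc nbc; set S := _ :\: _ in nbc *; set X := component S b.
have [/exists_inP[v vX h]|no] := boolP [exists v in X, (v \in s) && ~~ touch K v].
  by exists v.
exfalso; have allt v : v \in X -> v \in s -> touch K v.
  by move=> vX vs; apply: contraR no => nv; apply/exists_inP; exists v; rewrite ?vs.
have /and4P[Ip exb exc fxq] := cx.
have Us := ipath_uniq Ip.
have xs : x \in s by rewrite sE mem_head.
have bs : b \in s by rewrite sE !inE eqxx orbT.
have cs : c \in s by rewrite sE !inE mem_rcons mem_head !orbT.
have tu : touch K u by apply/touchP; exists w.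
have ux : u != x by apply: contraNneq nx => <-.
have tb : touch K b by have := cov xs bs exb; rewrite (negbTE nx).
have tc : touch K c by have := cov xs cs exc; rewrite (negbTE nx).
have [kb kbK ekb] := touchP _ _ tb; have [kc kcK ekc] := touchP _ _ tc.
have sS v : v \in s -> v != x -> v != u -> v \in S.
  move=> vs vx vu; rewrite !inE negb_or vu vx vs orbT !andbT /=.
  by apply: contraTneq wK => <-; apply: sK.
have KS v : v \in K -> v != w -> v \in S.
  move=> vK vw; rewrite !inE negb_or vw vK !andbT.
  by apply/andP; split; apply: contraTneq vK => ->; apply: sK.
have bS : b \in S by apply: sS; rewrite // eq_sym // adj_neq.
have cS : c \in S by apply: sS; rewrite // eq_sym // adj_neq.
have bX : b \in X by apply: mem_component.
have cX : c \notin X by rewrite inE cS.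
have XS v : v \in X -> v \in S by apply/subsetP/component_sub.
have [h [q' qE]] : exists h q', q = h :: q'.
  case: (q) sE => [|h q'] sE'; last by exists h, q'.
  by move: us; rewrite sE' !inE (negbTE ux) (negbTE ub) (negbTE uc).
move: (Ip); rewrite qE [rcons _ _]/= ipath_cons all_rcons => /and3P[_ ebh /andP[fbc _]].
have hsr : h \in s by rewrite sE qE !inE eqxx !orbT.
have hx : h != x.
  move: fxq; rewrite qE /= => /andP[+ _]; rewrite /far eq_sym; by case/andP.
(* An induced connection from [b] to [c] through [K] closes up with [x] to a second rim. The vertex
   [h] sees [b] on it, hence nothing of [L]. *)
have [t0 [t [It tK ebt ft]]] := ends_path cK (sK bs) (sK cs) kbK ekb kcK ekc.
have [L LE] : exists L, L = t0 :: t by exists (t0 :: t).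
have t0L : t0 \in L by rewrite LE mem_head.
rewrite -LE in tK.
have fxL : all (far x) L by apply/allP => k /tK; apply: untouched_far.
have IL : ipath (b :: rcons L c).
  by rewrite LE [rcons _ _]/= ipath_cons It ebt all_rcons fbc ft.
have LP v : v \in L -> v \in [:: x, b & rcons L c].
  by move=> vL; rewrite inE inE mem_rcons inE vL !orbT.
have hD : hole [:: x, b & rcons L c].
  by apply: cyc_hole; rewrite /cyc IL exb exc fxL.
have hnD : h \notin [:: x, b & rcons L c].
  rewrite inE inE mem_rcons inE !negb_or hx eq_sym (adj_neq ebh) !andTb.
  apply/andP; split; last by apply/negP => /tK/dis; rewrite hsr.
  move: Us; rewrite qE /= !mem_rcons !inE !negb_or.
  by case/and3P=> _ /andP[].
have hL k : k \in L -> ~~ e h k.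
  move=> kL; apply/negP => ehk; have : b = k.
    by apply: (once hD hnD _ (LP _ kL) _ ehk); rewrite 1?esym // !inE eqxx orbT.
  by move=> bk; move: (tK _ kL); rewrite -bk (negbTE (sK bs)).
(* Otherwise the connection would survive the deletion of [u] and [w]. *)
have wL : w \in L.
  apply: contraNT nbc => wL; apply: (@con_ipath _ (b :: rcons L c)).
  - exact: IL.
  - move=> v; rewrite inE mem_rcons inE => /or3P[/eqP->//|/eqP->//|vL].
    by apply: KS; [apply: tK|apply: contraNneq wL => <-].
  - exact: mem_head.
  - by rewrite inE mem_rcons mem_head orbT.
have uh : u != h by apply: contraTneq euw => ->; apply: hL.
have hX : h \in X by apply: (component_closed bX _ ebh); apply: sS; rewrite // eq_sym.
have [v0 v0K ehv0] := touchP _ _ (allt _ hX hsr).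
have v0L : v0 \notin L by apply/negP => /hL; rewrite ehv0.
have v0w : v0 != w by apply: contraNneq v0L => ->.
have v0X : v0 \in X by apply: (component_closed hX _ ehv0); apply: KS.
(* This set is connected because vertices of [K] outside [X] reach [w] without entering [X], and [w]
   lies on [L]. It misses [v0]. *)
have [|||v' [v'K v'X1 cv']] := @noncut (K :\: X :|: [set v in L]) K.
- apply: (@conn_hub _ w) => v /setUP[/setDP[vK vX]|]; last first.
    rewrite inE => vL; apply: (con_sub (subsetUr _ _)).
    apply: (con_ipath (s := L)) => //; last by move=> k kL; rewrite inE.
    by apply: (@ipath_catl _ [:: c]); rewrite cats1; apply: (@ipath_catr [:: b]).
  have [->|vw] := eqVneq v w; first exact: con_refl.
  have := con_first vK vw (connP _ cK v w vK wK); rewrite con_sym.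
  apply: con_sub; apply/subsetP => z /setU1P[->|].
    by rewrite in_setU !inE wL orbT.
  rewrite inE => /andP[/setD1P[zw zK] cvz]; rewrite in_setU in_setD zK andbT.
  apply/orP; left; apply: contra vX => zX; rewrite inE KS //=.
  have := zX; rewrite inE => /andP[_ cbz]; apply: con_trans cbz _.
  rewrite con_sym; apply: con_sub cvz; apply/subsetP => y /setD1P[yw yK].
  exact: KS.
- exact: cK.
- rewrite properE; apply/andP; split.
    by apply/subsetP => v /setUP[/setDP[]//|]; rewrite inE => /tK.
  apply/subsetPn; exists v0 => //.
  by rewrite in_setU in_setD v0X inE (negbTE v0L).
move: v'X1; rewrite in_setU in_setD v'K andbT negb_or negbK inE => /andP[v'X v'L].
have [a [y [as_ ys eay ny [eav av]]]] := priv v'K cv'.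
have au : a != u.
  by apply: contraNneq v'L => au; rewrite -(av w) ?au.
have ax : a != x by apply: contraNneq nx => <-; apply/touchP; exists v'.
have aX : a \in X by apply: (component_closed v'X); [apply: sS|rewrite esym].
have yu : y != u by apply: contraNneq ny => ->.
(* If [y] is [x], then [a] is [b], which also sees [t0] on [L], or [c], which is outside [X]. If
   not, [y] lies in [X] and should be touched. *)
have [yx|yx] := eqVneq y x.
  have := cyc_nbr cx (v := a); rewrite -sE as_ -yx esym eay => /(_ isT isT)[ab|ac].
    by case/negP: v'L; rewrite -(av t0) ?tK // ab.
  by rewrite -ac aX in cX.
have yX : y \in X by apply: (component_closed aX _ eay); apply: sS.
by case/negP: ny; apply: allt.
Qed.

(** An untouched [x'] on the side [X] of [b] has its own pivot [u'], [w']. This pivot lies in [X] up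
    to the vertices [u] and [w], so all that remains outside [X] stays connected to [c]. One of the
    two sides at [x'] is then properly contained in [X]. *)
Lemma descent n x b q c u w :
  cyc x b q c -> s =i [:: x, b & rcons q c] -> ~~ touch K x ->
  u \in s -> w \in K -> e u w -> u != b -> u != c ->
  ~~ con_in (off x :\: [set u; w]) b c ->
  #|component (off x :\: [set u; w]) b| < n -> False.
Proof.
elim: n x b q c u w => // n IHn x b q c u w cx sE nx us wK euw ub uc nbc ltn.
have [x' + /andP[x's nx']] := untouched_rim_vertex cx sE nx us wK euw ub uc nbc.
have reach v := @pivot_reach x b q c cx sE nx u w v us wK euw.
move: nbc ltn reach; set S := _ :\: _; set X := component S b => nbc ltn reach x'X.
have /and4P[Ip exb exc fxq] := cx.
have xs : x \in s by rewrite sE mem_head.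
have bs : b \in s by rewrite sE !inE eqxx orbT.
have cs : c \in s by rewrite sE !inE mem_rcons mem_head !orbT.
have tu : touch K u by apply/touchP; exists w.
have ux : u != x by apply: contraNneq nx => <-.
have tb : touch K b by have := cov xs bs exb; rewrite (negbTE nx).
have tc : touch K c by have := cov xs cs exc; rewrite (negbTE nx).
have sKn a k : a \in s -> k \in K -> a != k.
  by move=> as_ kK; apply: contraTneq as_ => ->; apply: dis.
have sS v : v \in s -> v != x -> v != u -> v \in S.
  by move=> vs vx vu; rewrite !inE negb_or vu vx vs orbT !andbT /= sKn.
have KS v : v \in K -> v != w -> v \in S.
  move=> vK vw; rewrite !inE negb_or vw vK !andbT.
  by rewrite !(eq_sym v) !sKn.
have bS : b \in S by apply: sS; rewrite // eq_sym // adj_neq.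
have cS : c \in S by apply: sS; rewrite // eq_sym // adj_neq.
have cX : c \notin X by rewrite inE cS.
have XS v : v \in X -> v \in S by apply/subsetP/component_sub.
have uX : u \notin X by apply/negP => /XS; rewrite !inE eqxx.
have wX : w \notin X by apply/negP => /XS; rewrite !inE eqxx orbT.
have xX : x \notin X by apply/negP => /XS; rewrite !inE eqxx /= andbF.
have oneK k a a' : k \in K -> a \in s -> a' \in s -> e a k -> e a' k -> a = a'.
  move=> kK as_ a's eak ea'k.
  by apply: (once hs (dis kK) as_ a's); rewrite esym.
have [b' [q' [c' [cx' sE']]]] := hole_at hs x's.
have /and4P[Ip' exb' exc' _] := cx'.
have b's : b' \in s by rewrite sE' !inE eqxx orbT.
have c's : c' \in s by rewrite sE' !inE mem_rcons mem_head !orbT.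
have tb' : touch K b' by have := cov x's b's exb'; rewrite (negbTE nx').
have tc' : touch K c' by have := cov x's c's exc'; rewrite (negbTE nx').
have nbrX a : a \in s -> touch K a -> e x' a -> a \in X \/ a = u.
  move=> as_ ta exa; have [|au] := eqVneq a u; first by right.
  left; apply: (component_closed x'X _ exa); apply: sS => //.
  by apply: contraNneq nx => <-.
have KX a : a \in s -> a \in X \/ a = u -> touch K a ->
    exists k, [/\ k \in w |: (X :&: K), k \in K & e a k].
  move=> as_ [aX|->] /touchP[k kK eak]; last by exists w; rewrite setU11.
  exists k; split=> //; rewrite in_setU1 in_setI kK andbT.
  have [//|kw /=] := eqVneq k w.
  by apply: (component_closed aX _ eak); apply: KS.
have cKX : connected (w |: (X :&: K)).
  apply: (@conn_hub _ w) => v /setU1P[->|/setIP[vX vK]]; first exact: con_refl.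
  have vw : v != w by apply: contraNneq wX => <-.
  have := con_first vK vw (connP _ cK v w vK wK); rewrite con_sym.
  apply: con_sub; apply: setUS; apply/subsetP => z.
  rewrite inE => /andP[/setD1P[zw zK] cvz]; rewrite in_setI zK andbT inE KS //=.
  have := vX; rewrite inE => /andP[_ cbv]; apply: con_trans cbv _.
  by apply: con_sub cvz; apply/subsetP => y /setD1P[yw yK]; apply: KS.
have [u' [w' [u's w'K euw' /andP[ub' uc'] nbc']]] := pivot cx' sE' nx'.
have tu' : touch K u' by apply/touchP; exists w'.
have ux' : u' != x' by apply: contraNneq nx' => <-.
have u'x : u' != x by apply: contraNneq nx => <-.
pose S' := off x' :\: [set u'; w'].
have sS' v : v \in s -> v != x' -> v != u' -> v \in S'.
  by move=> vs vx vu; rewrite !inE negb_or vu vx vs orbT !andbT /= sKn.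
have KS' v : v \in K -> v != w' -> v \in S'.
  move=> vK vw; rewrite !inE negb_or vw vK !andbT.
  by rewrite !(eq_sym v) !sKn.
have b'S : b' \in S' by apply: sS'; rewrite // eq_sym // adj_neq.
have c'S : c' \in S' by apply: sS'; rewrite // eq_sym // adj_neq.
(* If [w'] is elsewhere, the connected set [w |: (X :&: K)] survives the deletion and is touched by
   both [b'] and [c'], which are thus not separated. *)
have [w'KX|w'KX] := boolP (w' \in w |: (X :&: K)); last first.
  case/negP: nbc'.
  have [kb [kbX kbK ekb]] := KX _ b's (nbrX _ b's tb' exb') tb'.
  have [kc [kcX kcK ekc]] := KX _ c's (nbrX _ c's tc' exc') tc'.
  have sub : w |: (X :&: K) \subset S'.
    apply/subsetP => k kX; apply: KS'; last by apply: contraNneq w'KX => <-.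
    by case/setU1P: kX => [->//|/setIP[]].
  apply: (@con_trans _ kb); first exact: con_edge b'S (subsetP sub _ kbX) ekb.
  apply: (@con_trans _ kc); first by apply: (con_sub sub); apply: (connP _ cKX).
  by apply: con_edge (subsetP sub _ kcX) c'S _; rewrite esym.
(* When [w' = w], both [u] and [u'] are rim neighbours of [w], so they coincide by [once]. *)
have u'X : u' \in X \/ u' = u.
  have [->|u'u] := eqVneq u' u; [by right|left].
  case/setU1P: w'KX => [w'w|/setIP[w'X _]].
    by case/eqP: u'u; apply: (oneK w) => //; rewrite -w'w.
  by apply: (component_closed w'X); [apply: sS|rewrite esym].
have outS z : z \in S -> z \notin X -> z \in S'.
  move=> zS zX; have zx' : z != x' by apply: contraNneq zX => ->.
  have [zw zu] : z != w /\ z != u by move: zS; rewrite in_setD in_set2 negb_or => /andP[/andP[]].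
  have zu' : z != u' by case: u'X => [u'X|->//]; apply: contraNneq zX => ->.
  have zw' : z != w'.
    by case/setU1P: w'KX => [->//|/setIP[w'X _]]; apply: contraNneq zX => ->.
  case/setDP: zS => /setD1P[_ /setUP[zK _|zs _]]; first exact: KS'.
  by apply: sS'; rewrite ?inE in zs.
have cS' : c \in S' by apply: outS.
have compc : component S c \subset S'.
  apply/subsetP => z; rewrite inE => /andP[zS ccz]; apply: outS => //.
  by apply: contra nbc; rewrite inE zS /= => cbz; apply: con_trans cbz _; rewrite con_sym.
(* The vertex [x] is adjacent to [c], [u] reaches [c] along the rim and [w] reaches it through [K];
   any other vertex outside [X] reaches [c] by [pivot_reach]. *)
have outc z : z \in S' -> z \notin X -> con_in S' c z.
  move=> zS' zX; have [->|zx] := eqVneq z x.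
    apply: con_edge => //; last by rewrite esym.
    apply: sS' => //; first by apply: contraNneq xX => ->.
    by rewrite eq_sym.
  have [zu|zu] := eqVneq z u.
    have uP : u \in b :: rcons q c by move: us; rewrite sE inE (negbTE ux).
    case/splitPr E : _ / uP => [p1 p2].
    have I := Ip; rewrite E in I; have U := ipath_uniq I.
    have cp2 : c \in p2.
      have : last b (b :: rcons q c) = c by rewrite /= last_rcons.
      rewrite E last_cat /=; case: (p2) => [/= ucE|h p <-]; last exact: (mem_last h p).
      by rewrite ucE eqxx in uc.
    have Iup : ipath (u :: p2) := ipath_catr I.
    have sp2 v : v \in p2 -> v \in S.
      move=> vp; have vP : v \in b :: rcons q c by rewrite E mem_cat inE vp !orbT.
      have vu : v != u.
        by apply: contraTneq (ipath_uniq Iup) => <-; rewrite /= vp.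
      apply: sS vu; first by rewrite sE inE vP orbT.
      apply: contraTneq vP => ->; rewrite inE mem_rcons inE.
      rewrite (negbTE (adj_neq exb)) (negbTE (adj_neq exc)) /=.
      by apply/negP => /(allP fxq); rewrite /far eqxx.
    rewrite zu con_sym; apply: (con_ipath Iup); rewrite ?mem_head ?inE ?cp2 ?orbT //.
    move=> v /predU1P[->|vp]; first by rewrite -zu.
    apply: (subsetP compc); rewrite inE sp2 //=.
    by apply: (con_ipath (ipath_catr (s := [:: u]) Iup)).
  have [zw|zw] := eqVneq z w.
    have [kc kcK ekc] := touchP _ _ tc.
    have kcw : kc != w.
      by apply: contraNneq uc => kw; apply/eqP; apply: (oneK w) => //; rewrite -kw.
    have kcS := KS _ kcK kcw.
    have ckc : con_in S c kc by apply: con_edge.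
    have kcS' : kc \in S' by apply: (subsetP compc); rewrite inE kcS.
    apply: con_trans (con_edge cS' kcS' ekc) _.
    rewrite zw; have := con_first kcK kcw (connP _ cK kc w kcK wK).
    apply: con_sub; apply/subsetP => y /setU1P[->|]; first by rewrite -zw.
    rewrite inE => /andP[/setD1P[yw yK] cy]; apply: (subsetP compc).
    rewrite inE KS //=; apply: con_trans ckc _.
    by apply: con_sub cy; apply/subsetP => v /setD1P[vw vK]; apply: KS.
  have zS : z \in S.
    case/setDP: zS' => /setD1P[_ /setUP[zK _|zs _]]; first exact: KS.
    by apply: sS; rewrite ?inE in zs.
  apply: (con_sub compc); apply: component_con => //.
  case: (reach z zS) => -[]; last by rewrite con_sym.
  by rewrite con_sym => cbz; case/negP: zX; rewrite inE zS.
have shrink p : ~~ con_in S' p c -> #|component S' p| < n.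
  move=> npc; apply: leq_trans (ltn : #|X| <= n); apply: proper_card; rewrite properE.
  apply/andP; split; last first.
    by apply/subsetPn; exists x' => //; rewrite !inE eqxx /= andbF.
  apply/subsetP => z; rewrite inE => /andP[zS' cpz]; apply: contraR npc => zX.
  by apply: con_trans cpz _; rewrite con_sym; apply: outc.
(* As [b'] and [c'] are separated, at least one of them is not connected to [c]. If this is [c'],
   the rim is reversed at [x']. *)
have [cb'c|ncb'] := boolP (con_in S' b' c); last first.
  exact: IHn cx' sE' nx' u's w'K euw' ub' uc' nbc' (shrink _ ncb').
have ncc' : ~~ con_in S' c' c.
  by apply: contra nbc' => cc; apply: con_trans cb'c _; rewrite con_sym.
apply: (IHn x' c' (rev q') b' u' w' (cyc_rev cx') _ nx' u's w'K euw' uc' ub' _ (shrink _ ncc')).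
  by move=> v; rewrite sE' !(inE, mem_rcons, mem_rev) [(v == b') || _]orbCA.
by rewrite con_sym.
Qed.

(** A vertex that does not disconnect [K] yields through [priv] an untouched rim vertex, whose pivot
    starts the descent. *)
Lemma reduced_false : K != set0 -> False.
Proof.
case/set0Pn=> k kK.
have [|v [vK _ cv]] := noncut conn0 cK; first by rewrite properE sub0set; apply/subsetPn; exists k; rewrite ?inE.
have [a [x [_ xs _ nx _]]] := priv vK cv.
have [b [q [c [cx sE]]]] := hole_at hs xs.
have [u [w [us wK euw /andP[ub uc] nbc]]] := pivot cx sE nx.
exact: descent cx sE nx us wK euw ub uc nbc (ltnSn _).
Qed.

End Reduced.

(** If every rim edge were covered, an inclusion-minimal connected covering subset of [K] would meet
    the assumptions of [reduced_false]. *)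
Lemma uncovered_rim_edge s (K : {set T}) :
  hole s -> connected K -> {in K, forall k, k \notin s} ->
  exists a y, [/\ a \in s, y \in s, e a y, ~~ touch K a & ~~ touch K y].
Proof.
move=> hs cK dis.
pose covers (K' : {set T}) :=
  [forall a, forall y, [&& a \in s, y \in s & e a y] ==> touch K' a || touch K' y].
have coversP K' : covers K' -> {in s &, forall a y, e a y -> touch K' a || touch K' y}.
  by move=> /forallP h a y as_ ys eay; apply: (implyP (forallP (h a) y)); rewrite as_ ys.
have ncovers K' : ~~ covers K' ->
  exists a y, [/\ a \in s, y \in s, e a y, ~~ touch K' a & ~~ touch K' y].
  case/forallPn=> a /forallPn[y]; rewrite negb_imply negb_or => /andP[/and3P[as_ ys eay] /andP[na ny]].
  by exists a, y.
have [covK|] := boolP (covers K); last exact: ncovers.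
exfalso; pose A := [pred K' : {set T} | connected K' && covers K'].
have [|K' /minsetP[/andP[cK' covK'] minK] K'K] := @minset_exists _ A K; first by rewrite /= cK.
have dis' : {in K', forall k, k \notin s} by move=> k /(subsetP K'K); apply: dis.
have [x [y [q [z [sE c]]]]] := hs.
have [xs ys] : x \in s /\ y \in s by rewrite sE !inE !eqxx orbT.
have exy : e x y by case/and4P: c.
apply: (@reduced_false s K' hs cK' dis' (coversP _ covK')); last first.
  by apply: contraTneq (coversP _ covK' _ _ xs ys exy) => ->; rewrite negb_or; apply/andP; split; apply/touchP => -[k]; rewrite inE.
move=> v vK' cv.
have ncv : ~~ covers (K' :\ v).
  apply/negP => cov'; have := minK (K' :\ v); rewrite /= cv cov' subD1set => /(_ isT isT) E.
  by move: vK'; rewrite -E !inE eqxx.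
have [a [a' [as_ a's eaa na na']]] := ncovers _ ncv.
have only k a0 : ~~ touch (K' :\ v) a0 -> k \in K' -> e a0 k -> k = v.
  move=> n0 kK ek; apply/eqP; apply: contraNT n0 => kv.
  by apply/touchP; exists k; rewrite // !inE kv.
(* An edge covered by [K'] but not by [K' :\ v] has an end touched through [v] alone. The other end
   is then untouched, for otherwise [v] would see both. *)
have main a0 a1 : a0 \in s -> a1 \in s -> e a0 a1 -> touch K' a0 ->
    ~~ touch (K' :\ v) a0 -> ~~ touch (K' :\ v) a1 ->
   exists a y : T, [/\ a \in s, y \in s, e a y, ~~ touch K' y
     & e a v /\ {in K', forall k, e a k -> k = v}].
  move=> a0s a1s e01 t0 n0 n1; have [k kK e0k] := touchP _ _ t0.
  have kv := only _ _ n0 kK e0k; rewrite kv in e0k.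
  exists a0, a1; split=> //; last by split=> // k' k'K; apply: only.
  apply/touchP => -[k' k'K e1k]; have k'v := only _ _ n1 k'K e1k; rewrite k'v in e1k.
  suff a01 : a0 = a1 by rewrite a01 eirr in e01.
  by apply: (once hs (dis' _ vK') a0s a1s); rewrite esym.
case/orP: (coversP _ covK' _ _ as_ a's eaa) => t; first exact: (main a a').
by apply: (main a' a) => //; rewrite esym.
Qed.


Lemma con_component (S : {set T}) x y z : y \in component S x -> z \in component S y -> z \in component S x.
Proof.
rewrite !inE => /andP[_ cxy] /andP[-> cyz]; exact: con_trans cxy cyz.
Qed.

Lemma component_sym (S : {set T}) x y : x \in S -> y \in component S x -> x \in component S y.
Proof. by rewrite !inE => -> /andP[_]; rewrite con_sym. Qed.

(** * Light edges *)

Definition nbrs x := [set y | e x y].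

Section TwoConnected.
Variable V : {set T}.
Hypothesis conV : forall v, connected (V :\ v).
Hypothesis closV : forall v w, e v w -> w \in V.

(** Contrary to what the name suggests, this is the part of [V] off the chordless cycle. *)
Let rim (s : seq T) := V :\: [set v in s].

Let rimE s v : v \in rim s -> v \in V /\ v \notin s.
Proof. by case/setDP => vV; rewrite inE. Qed.

Let rimI (s : seq T) v : v \in V -> v \notin s -> v \in rim s.
Proof. by move=> vV vs; rewrite !inE vs. Qed.

(** The new rim goes from [y] through [Y] to [y2] and back along [p1] to [b]. It avoids [K] and
    drops [a], which joins the component of [v] and makes it larger than [K]. *)
Lemma reroute y b q c p1 y2 p2 t v a k :
  let s := [:: y, b & rcons q c] in
  let Y := component (rim s) t in let K := component (rim s) v in
  cyc y b q c -> {subset s <= V} -> t \in rim s -> v \in rim s -> v \notin Y ->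
  e y t -> ~~ touch K y -> b :: rcons q c = p1 ++ y2 :: p2 ->
  touch Y y2 -> ~~ has (touch Y) p1 -> a \in p2 -> k \in K -> e a k ->
  exists s', [/\ hole s', {subset s' <= V}, v \in rim s' & #|K| < #|component (rim s') v|].
Proof.
move=> s Y K cy sV tS vS vY eyt nK E tY nY ap kK eak.
have /and4P[Ip eyb eyc fyq] := cy.
have Up := ipath_uniq Ip.
have Ys z : z \in Y -> z \in V /\ z \notin s.
  by move/(subsetP (component_sub _ _))/rimE.
have Ks z : z \in K -> z \in V /\ z \notin s.
  by move/(subsetP (component_sub _ _))/rimE.
have Ps z : z \in b :: rcons q c -> z \in s by move=> zP; rewrite inE zP orbT.
have y2P : y2 \in b :: rcons q c by rewrite E mem_cat mem_head orbT.
have sY z : z \in s -> z \notin Y by apply: contraL => /Ys[].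
have [v0 v0Y ev0] := touchP _ _ tY.
have ys : y \in s by rewrite mem_head.
have [u [t' [I sub eyu fyt]]] := ends_path (component_conn tS) (sY _ ys) (sY _ (Ps _ y2P))
  (mem_component tS) eyt v0Y ev0.
(* [w] is the stretch after [b] up to [y2], empty when [y2] is [b] itself. *)
have [w wE] : exists w, rcons p1 y2 = b :: w.
  by move: E; case: (p1) => [[-> _]|h p [-> _]]; [exists [::]|exists (rcons p y2)].
have [p2' p2E] : exists p2', p2 = rcons p2' c.
  case/lastP: p2 E ap => // p2 z E _; exists p2.
  by have := congr1 (last b) E; rewrite last_cat /= !last_rcons => ->.
have qE : q = w ++ p2'.
  move: E; rewrite -cat_rcons wE p2E -rcons_cat rcons_cons => -[] /rcons_inj[].
  by [].
have wP z : z \in b :: w -> z \in b :: rcons q c.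
  by rewrite -wE E -cat_rcons mem_cat => ->.
have p1P z : z \in p1 -> z \in b :: rcons q c by move=> zp; rewrite E mem_cat zp.
have Yp1 z z' : z \in Y -> z' \in p1 -> far z z'.
  move=> zY z'p; have /hasPn/(_ _ z'p) n := nY.
  rewrite /far; apply/andP; split.
    by apply: contraTneq zY => ->; apply/sY/Ps/p1P.
  by apply: contra n => ezz; apply/touchP; exists z; rewrite // esym.
pose s' := [:: y, u & rcons (t' ++ rev w) b].
have s'E z : z \in s' -> [\/ z = y, z \in Y | z \in b :: w].
  move=> zs'; have : [|| z == y, z == u, z == b, z \in t' | z \in w].
    by move: zs'; rewrite !inE mem_rcons inE mem_cat mem_rev.
  case/or4P=> [/eqP->|/eqP->|/eqP->|/orP[zt|zw]].
  - by constructor 1.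
  - by constructor 2; apply: sub; rewrite mem_head.
  - by constructor 3; rewrite mem_head.
  - by constructor 2; apply: sub; rewrite inE zt orbT.
  - by constructor 3; rewrite inE zw orbT.
have hs' : hole s'.
  apply: cyc_hole; rewrite /cyc eyu eyb all_cat fyt all_rev.
  have -> : all (far y) w by move: fyq; rewrite qE all_cat => /andP[].
  rewrite !andbT rcons_cat -rev_cons -wE rev_rcons -cat_cons lastI.
  have I' : ipath (belast u t' ++ last u t' :: [:: y2]) by rewrite -cat_rcons -lastI cats1.
  apply: ipath_cat.
  - by rewrite -lastI; apply: (@ipath_catl _ [:: y2]); rewrite cats1.
  - rewrite -rev_rcons ipath_rev; apply: (@ipath_catl _ p2).
    by rewrite cat_rcons -E.
  - by have := ipath_path I; rewrite rcons_path => /andP[].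
  - by rewrite all_rev; apply/allP => z; apply/Yp1/sub/mem_last.
  - rewrite allrel_consr -allrel1r (ipath_far I') /=.
    by apply/allrelP => z z' /mem_belast/sub zY; rewrite mem_rev; apply: Yp1.
have KY z : z \in K -> z \notin Y.
  move=> zK; apply: contra vY => zY; apply: con_component zY _.
  exact: component_sym zK.
have Ks' z : z \in K -> z \in rim s'.
  move=> zK; have [zV zs] := Ks _ zK; apply: rimI => //.
  apply/negP => /s'E[zy|zY|zw].
  - by rewrite zy ys in zs.
  - by have := KY _ zK; rewrite zY.
  - by rewrite (Ps _ (wP _ zw)) in zs.
have vK : v \in K by apply: mem_component.
have KK' : K \subset component (rim s') v.
  apply/subsetP => z zK; rewrite inE Ks' //=.
  apply: (con_sub (S := K)); first by apply/subsetP => z'; apply: Ks'.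
  by apply: (connP _ (component_conn vS)).
exists s'; split=> //.
- move=> z /s'E[->|/Ys[]//|/wP/Ps/sV//]; exact: sV.
- exact: Ks'.
have aP : a \in b :: rcons q c by rewrite E mem_cat inE ap !orbT.
have aw : a \notin b :: w.
  by move: Up; rewrite E -cat_rcons wE cat_uniq => /and3P[_ /hasPn/(_ _ ap)].
have ay : a != y.
  apply: contraTneq aP => ->; rewrite inE mem_rcons inE.
  rewrite (negbTE (adj_neq eyb)) (negbTE (adj_neq eyc)) /=.
  by apply/negP => /(allP fyq); rewrite /far eqxx.
have as' : a \in rim s'.
  apply: rimI; first exact: sV (Ps _ aP).
  apply/negP => /s'E[/eqP|aY|/(negP aw)//]; first by rewrite (negbTE ay).
  by have := sY _ (Ps _ aP); rewrite aY.
apply: proper_card; rewrite properE KK' /=; apply/subsetPn; exists a.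
  by apply: (component_closed (subsetP KK' _ kK) as'); rewrite esym.
by apply/negP => /Ks[_]; rewrite (Ps _ aP).
Qed.

(** Otherwise deleting [a] would cut the component of [z] off from the rest of the rim. *)
Lemma touching s z a : hole s -> {subset s <= V} -> z \in rim s -> a \in s ->
  exists x, [/\ x \in s, x != a & touch (component (rim s) z) x].
Proof.
move=> hs sV zS as_.
have [/exists_inP[x xs /andP[xa tx]]|no] :=
    boolP [exists x in s, (x != a) && touch (component (rim s) z) x]; first by exists x.
have [b [q [c [ca sE]]]] := hole_at hs as_.
have eab : e a b by case/and4P: ca.
have bs : b \in s by rewrite sE !inE eqxx orbT.
have [zV zs] := rimE zS.
have za : z != a by apply: contraNneq zs => ->.
have zVa : z \in V :\ a by rewrite !inE za.
have bVa : b \in V :\ a by rewrite !inE eq_sym adj_neq // sV.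
have : b \in component (rim s) z.
  apply: (con_closed (P := fun x => x \in component (rim s) z) _ (connP _ (conV a) _ _ zVa bVa) (mem_component zS)).
  move=> x y xC /setD1P[ya yV] _ exy.
  have [ys|ys] := boolP (y \in s); last exact: component_closed xC (rimI yV ys) exy.
  case/exists_inP: no; exists y => //; rewrite ya; apply/touchP; exists x => //.
  by rewrite esym.
by move/(subsetP (component_sub _ _))/rimE => [_]; rewrite bs.
Qed.

(** A third neighbour of [y] lies in another component [Y]. Seen from one of the two ends of the rim
    path, some vertex touching [K] comes after the first vertex touching [Y], and [reroute] applies
    from that end. *)
Lemma untouched_degree s v y : hole s -> {subset s <= V} -> v \in rim s -> y \in s ->
  ~~ touch (component (rim s) v) y -> 2 < #|nbrs y| ->
  exists s', [/\ hole s', {subset s' <= V}, v \in rim s'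
    & #|component (rim s) v| < #|component (rim s') v|].
Proof.
move=> hs sV vS ys nK deg; have [b [q [c [cy sE]]]] := hole_at hs ys.
have [t eyt ts] : exists2 t, e y t & t \notin s.
  have [/exists_inP[t eyt ts]|no] := boolP [exists t in nbrs y, t \notin s].
    by exists t => //; rewrite inE in eyt.
  have : nbrs y \subset [set b; c].
    apply/subsetP => t yt; have ts : t \in s.
      by apply: contraR no => ts; apply/exists_inP; exists t.
    rewrite inE in yt; rewrite sE in ts; rewrite in_set2.
    by case: (cyc_nbr cy ts yt) => ->; rewrite eqxx ?orbT.
  move/subset_leq_card; rewrite cards2 => h; move: (leq_trans deg h); by case: (_ != _).
have rE : rim s = rim [:: y, b & rcons q c].
  by apply/setP => z; rewrite !in_setD !in_set sE.
rewrite rE in vS nK *; set s0 := [:: y, b & rcons q c] in vS nK sE rE *.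
have sV0 : {subset s0 <= V} by move=> z; rewrite -sE; apply: sV.
have tS : t \in rim s0 by apply: rimI; rewrite -?sE //; apply: closV eyt.
set K := component (rim s0) v in nK *; pose Y := component (rim s0) t.
have vY : v \notin Y.
  apply: contra nK => vY; apply/touchP; exists t => //.
  exact: component_sym vY.
have Ks z : z \in K -> z \in V /\ z \notin s0.
  by move/(subsetP (component_sub _ _))/rimE.
have vK : v \in K by apply: mem_component.
have y0 : y \in s0 by rewrite mem_head.
have sP x : x \in s0 -> x != y -> x \in b :: rcons q c.
  by rewrite inE => /predU1P[->|//]; rewrite eqxx.
have h0 : hole s0 := cyc_hole cy.
have [y1 [y1s y1y tY1]] := touching h0 sV0 tS y0.
have [a1 [a1s a1y tK1]] := touching h0 sV0 vS y0.
have [a2 [a2s a21 tK2]] := touching h0 sV0 vS a1s.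
have a2y : a2 != y by apply: contraNneq nK => <-.
have hasY : has (touch Y) (b :: rcons q c) by apply/hasP; exists y1; rewrite ?sP.
have [p1 [y2 [p2 [E ty2 n1]]]] := split_first hasY.
have done_at b' q' c' p1' y2' p2' a : cyc y b' q' c' -> s =i [:: y, b' & rcons q' c'] ->
    b' :: rcons q' c' = p1' ++ y2' :: p2' -> touch Y y2' -> ~~ has (touch Y) p1' ->
    a \in p2' -> touch K a -> 
    exists s', [/\ hole s', {subset s' <= V}, v \in rim s' & #|K| < #|component (rim s') v|].
  move=> cy' sE' E' t2 n2 ap /touchP[k kK eak].
  have rE' : rim s0 = rim [:: y, b' & rcons q' c'].
    by apply/setP => z; rewrite !in_setD !in_set -sE -sE'.
  rewrite /K rE'; apply: (@reroute y b' q' c' p1' y2' p2' t v a k cy'); rewrite -?rE' //.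
  by move=> z; rewrite -sE'; apply: sV.
have [a11|na1] := boolP (a1 \in p2); first exact: (done_at _ _ _ _ _ _ _ cy sE E ty2 n1 a11 tK1).
have [a22|na2] := boolP (a2 \in p2); first exact: (done_at _ _ _ _ _ _ _ cy sE E ty2 n1 a22 tK2).
(* Two vertices touching [K] are at hand, both different from [y], so one of them is not [y2]. *)
have [a [ap1 tKa]] : exists a, a \in p1 /\ touch K a.
  have := sP _ a1s a1y; rewrite E mem_cat inE (negbTE na1) orbF => /orP[h|/eqP a1E].
    by exists a1.
  have := sP _ a2s a2y; rewrite E mem_cat inE (negbTE na2) orbF -a1E (negbTE a21) orbF.
  by exists a2.
have ER : c :: rcons (rev q) b = rev (b :: rcons q c) by rewrite rev_cons rev_rcons.
have hasY' : has (touch Y) (c :: rcons (rev q) b) by rewrite ER has_rev.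
have [r1 [y3 [r2 [E' ty3 n3]]]] := split_first hasY'.
apply: (done_at _ _ _ _ _ _ a (cyc_rev cy) _ E' ty3 n3 _ tKa).
  by move=> z; rewrite sE !(inE, mem_rcons, mem_rev) [(z == b) || _]orbCA.
have nYa : ~~ touch Y a by have /hasPn/(_ _ ap1) := n1.
have Up : uniq (b :: rcons q c) by apply: ipath_uniq; case/and4P: cy.
have EE : b :: rcons q c = rev r2 ++ y3 :: rev r1.
  by rewrite -[LHS]revK -ER E' rev_cat rev_cons cat_rcons.
have : a \in b :: rcons q c by rewrite E mem_cat ap1.
rewrite EE mem_cat inE !mem_rev => /or3P[//|/eqP ay3|ar1].
  by rewrite ay3 ty3 in nYa.
(* In the remaining case [a] comes after [y3], and [y2] after [a]. Then [y2] lies in [rev r1], where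
   nothing touches [Y]. *)
have [z1 [z2 Z]] : exists z1 z2, p1 = z1 ++ a :: z2 by case/splitPr: ap1 => z1 z2; exists z1, z2.
have [w1 [w2 W]] : exists w1 w2, rev r1 = w1 ++ a :: w2.
  by rewrite -mem_rev in ar1; case/splitPr: ar1 => w1 w2; exists w1, w2.
have /eqP : z1 ++ a :: (z2 ++ y2 :: p2) = (rev r2 ++ y3 :: w1) ++ a :: w2.
  by rewrite -catA cat_cons -W -EE E Z -catA.
rewrite uniq_eqseq_pivotl; last by rewrite -cat_cons catA -Z -E.
case/andP=> _ /eqP w2E; have : y2 \in rev r1 by rewrite W -w2E mem_cat inE mem_cat inE eqxx !orbT.
by rewrite mem_rev => /(hasPn n3); rewrite ty2.
Qed.

Lemma light_edge x : x \in V -> {in V, forall y, 1 < #|nbrs y|} ->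
  exists a y, [/\ e a y, #|nbrs a| <= 2 & #|nbrs y| <= 2].
Proof.
move=> xV deg.
(* As long as an end of the uncovered edge has degree above 2, a larger component exists; [n] bounds
   the room left for growth in [V]. *)
have grow n s v : hole s -> {subset s <= V} -> v \in rim s ->
    #|V| < #|component (rim s) v| + n ->
    exists a y, [/\ e a y, #|nbrs a| <= 2 & #|nbrs y| <= 2].
  elim: n s v => [|n IHn] s v hs sV vS lt.
    have : #|component (rim s) v| <= #|V|.
      apply/subset_leq_card/subsetP => z.
      by move/(subsetP (component_sub _ _))/rimE => [].
    by rewrite leqNgt; rewrite addn0 in lt; rewrite lt.
  have [|a [y [as_ ys eay na ny]]] := uncovered_rim_edge hs (component_conn vS).
    by move=> k /(subsetP (component_sub _ _))/rimE[].
  have next z : z \in s -> ~~ touch (component (rim s) v) z -> 2 < #|nbrs z| ->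
      exists a y, [/\ e a y, #|nbrs a| <= 2 & #|nbrs y| <= 2].
    move=> zs nz dz; have [s' [hs' sV' vS' lt']] := untouched_degree hs sV vS zs nz dz.
    by apply: (IHn s' v hs' sV' vS'); apply: leq_trans lt _; rewrite addnS -addSn leq_add2r.
  have [da|da] := leqP #|nbrs a| 2; last exact: next da.
  have [dy|dy] := leqP #|nbrs y| 2; last exact: next dy.
  by exists a, y.
have [z1 [z2 [z1x z2x z12]]] : exists z1 z2, [/\ e x z1, e x z2 & z1 != z2].
  have /card_gt1P[z1 [z2 []]] := deg x xV.
  by rewrite !inE; exists z1, z2.
have nx z : e x z -> z \in V :\ x.
  by move=> exz; rewrite !inE (closV exz) andbT eq_sym adj_neq.
have [||m [l [cx sub]]] := path_hole (conV x) _ (nx _ z1x) (nx _ z2x) z1x z2x _.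
- by rewrite !inE eqxx.
- by rewrite eq_sym.
have hs := cyc_hole cx; set s := [:: _, _ & _] in hs.
have sV : {subset s <= V}.
  by move=> v; rewrite inE => /predU1P[->//|/sub/setD1P[]].
(* If the rim exhausts [V], every vertex on it sees only its two rim neighbours. *)
have [/exists_inP[v vV vs]|no] := boolP [exists v in V, v \notin s].
  exact: (grow #|V|.+1 s v hs sV (rimI vV vs) (leq_addl _ _)).
have light y : y \in s -> #|nbrs y| <= 2.
  move=> ys; have [b [q [c [cy sE]]]] := hole_at hs ys.
  apply: (@leq_trans #|[set b; c]|); last by rewrite cards2; case: (_ != _).
  apply/subset_leq_card/subsetP => t; rewrite inE => eyt; rewrite in_set2.
  have ts : t \in s.
    by apply: contraR no => ts; apply/exists_inP; exists t; rewrite ?(closV eyt).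
  by rewrite sE in ts; case: (cyc_nbr cy ts eyt) => ->; rewrite eqxx ?orbT.
exists x, z1; split=> //; apply: light; first exact: mem_head.
by rewrite !inE eqxx orbT.
Qed.

End TwoConnected.

End InducedPaths.

(** * Edge colouring *)

Section Subgraphs.
Variables (T : finType) (e e' : rel T) (W : pred T).
Hypotheses (esym' : symmetric e') (eirr' : irreflexive e').
Hypothesis agree : forall x y, W x -> W y -> e x y = e' x y.
Hypothesis covers : forall x a b, e' x a -> e' x b -> a != b -> W x.

Lemma far_agree x y : W x -> W y -> far e x y = far e' x y.
Proof. by move=> Wx Wy; rewrite /far agree. Qed.

Lemma ipath_agree s : all W s -> ipath e s = ipath e' s.
Proof.
elim: s => //= x s IHs /andP[Wx Ws]; rewrite IHs //; congr (_ && _).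
case: s {IHs} Ws => //= y s /andP[Wy Ws]; rewrite agree //; congr (_ && _).
by apply: eq_in_all => z /(allP Ws); apply: far_agree.
Qed.

Lemma hole_agree s : hole e' s -> hole e s /\ all W s.
Proof.
move=> hs; have Ws : all W s.
  apply/allP => r rs; have [y [q [z [/and4P[I ey ez _] _]]]] := hole_at esym' hs rs.
  apply: (covers ey ez); have := ipath_uniq eirr' I.
  by rewrite /= mem_rcons inE negb_or => /andP[/andP[]].
split=> //; have [x [y [q [z [sE c]]]]] := hs.
rewrite sE in Ws *; have [Wx Wp] : W x /\ all W (y :: rcons q z) by case/andP: Ws.
have [Wy /andP[Wz Wq]] : W y /\ W z && all W q by move: Wp; rewrite /= all_rcons => /andP[].
exists x, y, q, z; split=> //; move: c.
rewrite /cyc !agree // (ipath_agree Wp) => /and4P[-> -> -> /=].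
by congr is_true; apply: eq_in_all => v /(allP Wq); move=> Wv; rewrite far_agree.
Qed.

(** Each vertex of a propeller has two neighbours in it. A propeller of [e'] thus lies in [W], where
    both relations agree, and is one of [e]. *)
Lemma once_agree : sees_at_most_once e -> sees_at_most_once e'.
Proof.
move=> once s v a b hs vs as_ bs eva evb.
have [hs' /allP Ws] := hole_agree hs.
apply/eqP/negPn/negP => ab; have Wv := covers eva evb ab.
move/eqP: ab; apply; apply: (once s v) => //; by rewrite agree // Ws.
Qed.

End Subgraphs.

Definition proper_colouring (T : finType) (e : rel T) k (f : T -> T -> 'I_k) :=
  (forall x y, f x y = f y x) /\
  (forall x y z, e x y -> e x z -> y != z -> f x y != f x z).

(** Used to rename the colours of one side of a cut vertex. The colours listed with [S2] first are
    matched with those listed with the complement of [S1] first. *)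
Lemma separating_perm k (S1 S2 : {set 'I_k}) : #|S1| + #|S2| <= k ->
  exists g : 'I_k -> 'I_k, injective g /\ {in S2, forall i, g i \notin S1}.
Proof.
move=> le12; pose l := enum S2 ++ enum (~: S2); pose l' := enum (~: S1) ++ enum S1.
have ul : uniq l.
  rewrite cat_uniq !enum_uniq andbT /=; apply/hasPn => i.
  by rewrite !mem_enum inE.
have ul' : uniq l'.
  rewrite cat_uniq !enum_uniq andbT /=; apply/hasPn => i.
  by rewrite !mem_enum inE negbK.
have sl : size l = k by rewrite size_cat -!cardE cardsC card_ord.
have sl' : size l' = k by rewrite size_cat -!cardE addnC cardsC card_ord.
have lP i : i \in l by rewrite mem_cat !mem_enum inE orbN.
have li i : index i l < size l' by rewrite sl' -[X in _ < X]sl index_mem.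
exists (fun i => nth i l' (index i l)); split.
  move=> i j; rewrite (set_nth_default j) // => /eqP.
  rewrite nth_uniq // => /eqP h.
  by rewrite -(nth_index i (lP i)) h nth_index.
move=> i iS; have ie : i \in enum S2 by rewrite mem_enum.
have lt : index i l < size (enum (~: S1)).
  rewrite index_cat ie; apply: leq_trans (_ : size (enum S2) <= _); first by rewrite index_mem.
  rewrite -!cardE -(leq_add2l #|S1|) cardsC card_ord; exact: le12.
by rewrite nth_cat lt; have := mem_nth i lt; rewrite mem_enum inE.
Qed.

(** Induction on the number of adjacent ordered pairs. The number [k] is fixed and only bounds the
    degrees, so subgraphs of smaller maximum degree fit in. *)
Lemma edge_colouring n (T : finType) (e : rel T) k :
  symmetric e -> irreflexive e -> sees_at_most_once e -> 2 < k ->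
  (forall x, #|nbrs e x| <= k) -> #|[pred p : T * T | e p.1 p.2]| < n ->
  exists f : T -> T -> 'I_k, proper_colouring e f.
Proof.
elim: n e => // n IHn e esym eirr once k2 deg lt.
have smaller (e' : rel T) : symmetric e' -> sees_at_most_once e' ->
    (forall x y, e' x y -> e x y) -> (exists x y, e x y && ~~ e' x y) ->
    exists f : T -> T -> 'I_k, proper_colouring e' f.
  move=> esym' once' sub [x [y /andP[exy nexy]]]; apply: IHn => //.
  - by move=> z; apply/negP => /sub; rewrite eirr.
  - move=> z; apply: leq_trans (deg z); apply/subset_leq_card/subsetP => t.
    by rewrite !inE => /sub.
  rewrite -ltnS; apply: leq_trans lt; apply: proper_card; rewrite properE.
  apply/andP; split; first by apply/subsetP => p; rewrite !inE => /sub.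
  by apply/subsetPn; exists (x, y).
(* The bound [k.+2] counts [uv] at both ends: after its removal fewer than [k] edges meet it, so a
   colour is free. *)
have [/existsP[u /existsP[v /and3P[euv du duv]]]|nolight] :=
  boolP [exists u, exists v,
    [&& e u v, #|nbrs e u| <= 2 & #|nbrs e u| + #|nbrs e v| < k.+2]].
  pose uv x y := (x == u) && (y == v) || (x == v) && (y == u).
  have uvC x y : uv x y = uv y x by rewrite /uv orbC andbC [in X in _ || X]andbC.
  have uDv := adj_neq eirr euv.
  pose e' : rel T := [rel x y | e x y && ~~ uv x y].
  have esym' : symmetric e' by move=> x y; rewrite /e' /= esym uvC.
  have nu : #|nbrs e u| = #|nbrs e' u|.+1.
    rewrite (cardsD1 v) inE euv add1n; congr _.+1; apply: eq_card => y.
    by rewrite !inE /e' /= /uv eqxx (negbTE uDv) orbF andbC.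
  have nv : #|nbrs e v| = #|nbrs e' v|.+1.
    rewrite (cardsD1 u) inE esym euv add1n; congr _.+1; apply: eq_card => y.
    by rewrite !inE /e' /= /uv eqxx [v == u]eq_sym (negbTE uDv) /= andbC.
  have [||||f [fC fP]] := smaller e'.
  - exact: esym'.
  (* Without the edge [uv], [u] has at most one neighbour and belongs to no propeller. *)
  - apply: (@once_agree _ e e' (predC1 u)) => //.
    + by move=> x; rewrite /e' /= eirr.
    + by move=> x y /= /negbTE xu /negbTE yu; rewrite /e' /= /uv xu yu andbF andbT.
    + move=> x a b /= e1 e2 ab; apply: contraTneq du => xu; rewrite -ltnNge nu ltnS.
      have -> : 1 < #|nbrs e' u| = true; last by [].
      by apply/card_gt1P; exists a, b; rewrite !inE -xu e1 e2.
  - by move=> x y /andP[].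
  - by exists u, v; rewrite /e' /= euv /uv !eqxx.
  pose forb := [set f u y | y in nbrs e' u] :|: [set f v y | y in nbrs e' v].
  have lf : #|forb| < k.
    apply: leq_ltn_trans (leq_card_setU _ _) _.
    apply: leq_ltn_trans (leq_add (leq_imset_card _ _) (leq_imset_card _ _)) _.
    by move: duv; rewrite nu nv addSn addnS !ltnS.
  have [al alP] : exists al, al \notin forb.
    apply/existsP; rewrite -[[exists _, _]]negbK negb_exists; apply/forallP => h.
    move: lf; rewrite -[X in _ < X]card_ord -cardsT; apply/negP; rewrite -leqNgt.
    by apply/subset_leq_card/subsetP => i _; have := h i; rewrite negbK.
  have nal x y z : uv x y -> e x z -> y != z -> al != f x z.
    move=> xy exz yz; apply: contraNneq alP => ->.
    have nxz : ~~ uv x z.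
      apply: contra yz; move: xy; rewrite /uv.
      case/orP=> /andP[/eqP-> /eqP->]; first by rewrite eqxx (negbTE uDv) orbF eq_sym.
      by rewrite eqxx [v == u]eq_sym (negbTE uDv) /= eq_sym.
    have e'xz : e' x z by rewrite /e' /= exz.
    by rewrite inE; case/orP: xy => /andP[/eqP xE _]; rewrite -xE imset_f ?inE ?orbT.
  exists (fun x y => if uv x y then al else f x y); split=> [x y|x y z exy exz yz].
    by rewrite uvC fC.
  case: ifPn => xy; case: ifPn => xz.
  - move: xy xz yz; rewrite /uv.
    case/orP=> /andP[/eqP-> /eqP->]; rewrite eqxx.
      by rewrite (negbTE uDv) orbF => /= /eqP->; rewrite eqxx.
    by rewrite eq_sym (negbTE uDv) /= => /eqP->; rewrite eqxx.
  - exact: (nal _ _ _ xy exz yz).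
  - by rewrite eq_sym; apply: (nal _ _ _ xz exy); rewrite eq_sym.
  - by apply: fP; rewrite // /e' /= ?exy ?exz.
pose V := [set x | [exists y, e x y]].
have Ve x y : e x y -> x \in V by move=> exy; rewrite inE; apply/existsP; exists y.
have closV v w : e v w -> w \in V by rewrite esym; apply: Ve.
have k0 : 0 < k by apply: leq_trans k2.
have [/pred0P V0|/pred0Pn[x0 x0V]] := boolP (pred0b (mem V)).
  exists (fun _ _ => Ordinal k0); split=> // x y z /Ve; rewrite -[x \in V]/(mem V x) V0.
  by [].
(* An edge at a vertex of degree 1 satisfies the bound just excluded, as its other end has degree at
   most [k]. *)
have deg2 : {in V, forall y, 1 < #|nbrs e y|}.
  move=> y; rewrite inE => /existsP[z eyz]; rewrite ltnNge; apply: contra nolight => d1.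
  apply/existsP; exists y; apply/existsP; exists z; rewrite eyz /=.
  by rewrite (leq_trans d1) //= ltnS -[k.+1]add1n leq_add.
have [/existsP[v0]|conV] := boolP [exists v, ~~ connected e (V :\ v)]; last first.
  have [|a [y [eay da dy]]] := light_edge esym eirr once _ closV x0V deg2.
    by move=> v; move: conV; rewrite negb_exists => /forallP/(_ v); rewrite negbK.
  (* Two ends of degree at most 2 give a sum of at most 4, which is below [k.+2] because [k] is at
     least 3. *)
  case/negP: nolight; apply/existsP; exists a; apply/existsP; exists y.
  by rewrite eay da /= (leq_ltn_trans (leq_add da dy)) // !ltnS.
case/forall_inPn=> p pV /forall_inPn[q qV npq].
(* The edges are split into those meeting [Y] and the others. The two classes can share only the
   vertex [v0]; if [v0] is outside [V], then [V] itself is disconnected and they share none. *)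
pose Y := component e (V :\ v0) p; pose t x y := (x \in Y) || (y \in Y).
have tC x y : t x y = t y x by rewrite /t orbC.
have pY : p \in Y by apply: mem_component.
have qY : q \notin Y by rewrite inE qV.
have v0Y : v0 \notin Y by rewrite !inE eqxx.
have Yn x y : x \in Y -> e x y -> y != v0 -> y \in Y.
  by move=> xY exy yv; apply: (component_closed xY _ exy); rewrite in_setD1 yv (closV x).
pose e1 : rel T := [rel x y | e x y && t x y].
pose e2 : rel T := [rel x y | e x y && ~~ t x y].
have sym1 : symmetric e1 by move=> x y; rewrite /e1 /= esym tC.
have sym2 : symmetric e2 by move=> x y; rewrite /e2 /= esym tC.
have [p' epp'] : exists p', e p p' by case/setD1P: pV => _; rewrite inE => /existsP.
have [q' eqq'] : exists q', e q q' by case/setD1P: qV => _; rewrite inE => /existsP.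
have q'Y : q' \notin Y.
  apply: contra qY => q'Y; apply: (Yn q'); rewrite // 1?esym //.
  by case/setD1P: qV.
have [|||f1 [f1C f1P]] := smaller e1 sym1.
- apply: (@once_agree _ e e1 [pred x | (x == v0) || (x \in Y)]) => //.
  + by move=> x; rewrite /e1 /= eirr.
  + move=> x y /= Wx Wy; rewrite /e1 /=; case exy : (e x y) => //=; rewrite /t.
    case/predU1P: Wx => [xv|->//]; case/predU1P: Wy => [yv|->]; last by rewrite orbT.
    by rewrite xv yv eirr in exy.
  + move=> x a b /= /andP[exa ta] _ _; have [//|xv /=] := eqVneq x v0.
    case/orP: ta => // aY; apply: (Yn a) => //; by rewrite esym.
- by move=> x y /andP[].
- by exists q, q'; rewrite /e1 /= eqq' /t negb_or qY.
have [|||f2 [f2C f2P]] := smaller e2 sym2.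
- apply: (@once_agree _ e e2 [pred x | x \notin Y]) => //.
  + by move=> x; rewrite /e2 /= eirr.
  + by move=> x y /= /negbTE xY /negbTE yY; rewrite /e2 /= /t xY yY andbT.
  + by move=> x a b /= /andP[_]; rewrite negb_or => /andP[].
- by move=> x y /andP[].
- by exists p, p'; rewrite /e2 /= epp' /t pY.
pose S1 := [set f1 v0 y | y in nbrs e1 v0]; pose S2 := [set f2 v0 y | y in nbrs e2 v0].
(* At [v0] both classes together use at most as many colours as its degree, hence at most [k]. *)
have [|g [ginj gP]] := @separating_perm k S1 S2.
  apply: leq_trans (leq_add (leq_imset_card _ _) (leq_imset_card _ _)) (leq_trans _ (deg v0)).
  rewrite -(cardsID Y (nbrs e v0)); apply: leq_add; apply/subset_leq_card/subsetP => y.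
    rewrite [_ \in nbrs _ _]inE => /andP[ey]; rewrite /t (negbTE v0Y) => yY.
    by apply/setIP; rewrite inE.
  rewrite [_ \in nbrs _ _]inE => /andP[ey]; rewrite /t (negbTE v0Y) => yY.
  by apply/setDP; rewrite inE.
exists (fun x y => if t x y then f1 x y else g (f2 x y)); split=> [x y|x y z exy exz yz].
  by rewrite tC f1C f2C.
have mixed a b : e x a -> e x b -> t x a -> ~~ t x b -> f1 x a != g (f2 x b).
  move=> exa exb ta tb; have xv : x = v0.
    apply/eqP; apply: contraNT tb => xv; rewrite /t; apply/orP; left.
    case/orP: ta => // aY; apply: (Yn a) => //; by rewrite esym.
  rewrite xv in exa exb ta tb *; apply: contraNneq (gP (f2 v0 b) _) => [<-|].
    by apply: imset_f; rewrite inE /e1 /= exa.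
  by apply: imset_f; rewrite inE /e2 /= exb.
case: ifPn => ty; case: ifPn => tz.
- by apply: f1P; rewrite // /e1 /= ?exy ?exz.
- exact: mixed.
- by rewrite eq_sym; apply: mixed.
- by rewrite (inj_eq ginj); apply: f2P; rewrite // /e2 /= ?exy ?exz.
Qed.

(** * From propeller-free graphs to relations *)

Lemma next_at_last (T : eqType) (x y : T) p :
  uniq (y :: p) -> next_at (last y p) x y p = x.
Proof.
elim: p y => [|z p IHp] y /=; first by rewrite eqxx.
case/andP=> ny U; rewrite IHp // ifN //.
by apply: contraNneq ny => <-; apply: mem_last.
Qed.

(** Rotating the cycle to start at [u] leaves only its second and last entries as rim neighbours of
    [u]: these are its successor and its predecessor. *)
Lemma hole_chordless (G : sgraph) (s : seq G) :
  hole (@adj G) s -> chordless_cycle s.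
Proof.
move=> hs; have [x [y [q [z [sE /and4P[I exy exz fx]]]]]] := hs.
have irr := @adj_irrefl G; have sym := @adj_sym G.
have Us : uniq s.
  rewrite sE cons_uniq (ipath_uniq irr I) andbT inE mem_rcons inE !negb_or.
  rewrite (adj_neq irr exy) (adj_neq irr exz) /=.
  by apply/negP => /(allP fx); rewrite /far eqxx.
split=> //; first by rewrite sE /= size_rcons.
  rewrite sE /= exy rcons_path last_rcons sym exz andbT.
  exact: ipath_path I.
move=> u v us vs euv; have [y' [q' [z' [c E]]]] := hole_rot_at sym hs us.
have Ur : uniq [:: u, y' & rcons q' z'] by rewrite -E rot_uniq.
rewrite -!(next_rot (index u s) Us) E.
have vr : v \in [:: u, y' & rcons q' z'] by rewrite -E mem_rot.
have [->|->] := cyc_nbr irr c vr euv; first by left; rewrite /= eqxx.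
right; have := next_at_last u Ur.
by rewrite /= last_rcons.
Qed.

Lemma chordless_induced (G : sgraph) (S : {set G}) (c : seq (induced S)) :
  chordless_cycle (map val c : seq G) -> chordless_cycle c.
Proof.
case=> sz U cyc chord; rewrite size_map in sz; rewrite (map_inj_uniq val_inj) in U.
split=> //.
  by move: cyc; case: (c) => //= x p; rewrite -map_rcons path_map.
move=> x y xc yc exy; have := chord (val x) (val y) (map_f _ xc) (map_f _ yc) exy.
by rewrite !(next_map val_inj U) => -[/val_inj h|/val_inj h]; [left|right].
Qed.

Lemma propeller_free_once (G : sgraph) :
  ~ contains_induced_propeller G -> sees_at_most_once (@adj G).
Proof.
move=> free s v a b hs vs as_ bs va vb; apply/eqP/negPn/negP => ab; apply: free.
pose S := [set u in v :: s]; exists S.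
have inS u : u \in v :: s -> u \in S by move=> uvs; rewrite in_set.
have sS : all (mem S) s by apply/allP => u us; apply: inS; rewrite inE us orbT.
(* All of [s] lies in [S], so [insub] loses nothing. *)
pose c : seq (induced S) := pmap insub s.
have cE : map val c = s.
  rewrite (pmap_filter (@insubK _ _ _)); apply/all_filterP/allP => u us.
  by rewrite isSome_insub; apply: (allP sS).
have mem_c (u : induced S) : (u \in c) = (val u \in s).
  by rewrite -[in RHS]cE (mem_map val_inj).
have vS : v \in S by rewrite inS ?mem_head.
exists c, (exist _ v vS : induced S); split.
- by apply: chordless_induced; rewrite cE; apply: hole_chordless.
- by rewrite mem_c.
- have [aS bS] : a \in S /\ b \in S by split; apply: (allP sS).
  apply/card_gt1P; exists (exist _ a aS : induced S), (exist _ b bS : induced S).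
  by rewrite !inE !mem_c as_ bs.
by move=> y; rewrite inE mem_c -(inj_eq val_inj) /=; have := valP y; rewrite !inE.
Qed.

(** * Edges as two-element sets and the chromatic index *)

Section EdgeColourings.
Variable G : sgraph.

Lemma edge_ends (d : edge G) : exists p : G * G, adj p.1 p.2 && (val d == [set p.1; p.2]).
Proof. by have /imsetP[p pE ->] := valP d; exists p; rewrite eqxx andbT. Qed.

(** The order of the two ends is an arbitrary choice; the colour is independent of it because
    colourings are symmetric. *)
Definition ends (d : edge G) : G * G := xchoose (edge_ends d).

Lemma colour_endsE (C : Type) (f : G -> G -> C) (d : edge G) x y :
  (forall u v, f u v = f v u) -> x \in val d -> y \in val d -> x != y ->
  f (ends d).1 (ends d).2 = f x y.
Proof.
move=> fC xd yd xy; have /andP[_ /eqP dE] := xchooseP (edge_ends d).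
rewrite -/(ends d) in dE; move: xd yd; rewrite dE !in_set2.
by case/orP=> /eqP xE /orP[]/eqP yE; rewrite xE yE ?eqxx // in xy *.
Qed.

Lemma edge_other_end (d : edge G) x : x \in val d ->
  exists2 y, adj x y & val d = [set x; y].
Proof.
have /imsetP[[a b] ab ->] := valP d; rewrite inE /= in ab.
case/set2P=> ->; first by exists b.
by exists a; rewrite 1?adj_sym // setUC.
Qed.

Lemma proper_edge_colorable k (f : G -> G -> 'I_k) :
  proper_colouring (@adj G) f -> edge_colorable G k.
Proof.
case=> fC fP; apply/existsP; exists [ffun d => f (ends d).1 (ends d).2].
apply/forallP => d1; apply/forallP => d2; apply/implyP => /andP[nd /set0Pn[x /setIP[x1 x2]]].
have [y xy E1] := edge_other_end x1; have [z xz E2] := edge_other_end x2.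
have ne u : adj x u -> x != u by apply: adj_neq; apply: adj_irrefl.
rewrite !ffunE (colour_endsE fC x1 (y := y)) ?E1 ?set22 ?ne //.
rewrite (colour_endsE fC x2 (y := z)) ?E2 ?set22 ?ne //.
apply: fP => //; apply: contraNneq nd => yz; apply/eqP/val_inj.
by rewrite E1 E2 yz.
Qed.

(** The edges at [x] pairwise meet, so sending a neighbour to the colour of its edge is
    injective. *)
Lemma colorable_degree k (x : G) : edge_colorable G k -> #|neighbours x| <= k.
Proof.
case/existsP=> f /forallP fP; have xyE y : adj x y -> [set x; y] \in edges G.
  by move=> xy; apply/imsetP; exists (x, y); rewrite ?inE.
(* [None] is a default for the vertices not adjacent to [x], making the map total. *)
pose d y := if (insub [set x; y] : option (edge G)) is Some d then Some (f d) else None : option 'I_k.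
have dE y (xy : adj x y) : d y = Some (f (Sub [set x; y] (xyE y xy))).
  rewrite /d; case: insubP => [c _ cE|]; last by rewrite xyE.
  by congr (Some (f _)); apply: val_inj; rewrite cE.
have inj : {in neighbours x &, injective d}.
  move=> y z; rewrite !inE => xy xz; rewrite !dE => -[] fyz; apply/eqP.
  have xn u : adj x u -> u != x by move=> xu; rewrite eq_sym (adj_neq (@adj_irrefl G) xu).
  have /forallP/(_ (Sub [set x; z] (xyE z xz))) := fP (Sub [set x; y] (xyE y xy)).
  apply: contraTT => yz; rewrite negb_imply fyz eqxx andbT /adjacent_edges !SubK.
  apply/andP; split; last by apply/set0Pn; exists x; rewrite !inE eqxx.
  rewrite -val_eqE !SubK; apply: contraNneq yz => E.
  have : y \in [set x; z] by rewrite -E set22.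
  by rewrite in_set2 (negbTE (xn _ xy)).
have sub : d @: neighbours x \subset [set Some i | i : 'I_k].
  apply/subsetP => c /imsetP[y xy ->]; rewrite inE in xy.
  by rewrite dE; apply: imset_f.
rewrite -(card_in_imset inj); apply: leq_trans (subset_leq_card sub) _.
by apply: leq_trans (leq_imset_card _ _) _; rewrite card_ord.
Qed.

End EdgeColourings.

Theorem theorem5p5 (G : sgraph)
  (propeller_free : ~ contains_induced_propeller G)
  (max_degree_ge3 : 3 <= max_degree G) :
  chromatic_index G = max_degree G.
Proof.
rewrite /chromatic_index; case: ex_minnP => k colk mink; apply/eqP.
rewrite eqn_leq; apply/andP; split; last first.
  by apply/bigmax_leqP => x _; apply: colorable_degree.
apply: mink; have [|f fP] := @edge_colouring _ G (@adj G) (max_degree G) (@adj_sym G)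
  (@adj_irrefl G) (propeller_free_once propeller_free) max_degree_ge3 _ (ltnSn _).
  by move=> x; apply: (leq_bigmax x).
exact: proper_edge_colorable fP.
Qed.
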